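(* For every $\rho>0$ there is a constant $C_\rho>0$, depending only on $\rho$, and there is a universal constant $K>0$, such that the following holds. Let $N\geq 2$ be an integer with $0<\rho<\log^3(N)$, let $\Phi\in\mathbb{C}^{N\times N}$ be a universal sensing basis, let $\Psi\in\mathbb{C}^{N\times N}$ be an arbitrary orthonormal basis, let $c\in\mathbb{C}^N$ be a random Rademacher or Steinhaus sequence, and let $C\in\mathbb{C}^{N\times N}$ be the diagonal matrix with diagonal $c$. Let $\alpha\in\mathbb{C}^N$ be an $s$-sparse vector, let $\Omega=\{l_1,\dots,l_m\}$ consist of $m$ indices chosen independently and uniformly at random from $\{1,\dots,N\}$ (independently of $c$), put $A^{\mathrm c}=\Phi^*C\Psi$ and $y=A^{\mathrm c}_\Omega\,\alpha\in\mathbb{C}^m$. If $$m\geq C_\rho\, s\,\log^5(N),$$ then, with probability at least $1-K N^{-\rho}$ (over the draw of $c$ and $\Omega$), $\alpha$ is the unique minimizer of the $\ell_1$-minimization problem $$\min_{\alpha'\in\mathbb{C}^N}\|\alpha'\|_1\quad\text{subject to}\quad y=A^{\mathrm c}_\Omega\,\alpha'.$$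
   Context: An orthonormal basis of $\mathbb{C}^N$ is identified with the unitary matrix whose columns are the basis vectors. An orthonormal basis $\Phi\in\mathbb{C}^{N\times N}$ is called a universal sensing basis if all its entries $\phi_{ki}$, $1\leq k,i\leq N$, have equal complex magnitude (e.g. the Fourier or Hadamard basis). $\cdot^*$ denotes the conjugate transpose, $\|\alpha\|_1=\sum_{i=1}^N|\alpha_i|$ with $|\cdot|$ the complex magnitude, and $\log$ is the natural logarithm. A Rademacher sequence is a vector of independent entries, each uniform on $\{-1,+1\}$; a Steinhaus sequence is a vector of independent entries, each uniform on the complex unit circle. A vector is $s$-sparse ($s\geq 1$) if it has at most $s$ non-zero entries. For a matrix $A$ with $N$ rows, $A_\Omega$ is the matrix with $m$ rows whose $r$-th row is the $l_r$-th row of $A$, $r=1,\dots,m$ (indices may be repeated). Thus $A^{\mathrm c}_\Omega=\Phi^*_\Omega C\Psi\in\mathbb{C}^{m\times N}$. *)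

(* Defs.v *)
From mathcomp Require Export all_boot all_order all_algebra.
From mathcomp Require Export complex.
From mathcomp Require Export all_classical all_reals all_analysis.
From mathcomp Require Export sesquilinear spectral.

Set Implicit Arguments.
Unset Strict Implicit.
Unset Printing Implicit Defensive.

Export Order.TTheory GRing.Theory Num.Theory.

Local Open Scope classical_set_scope.
Local Open Scope ring_scope.
Local Open Scope sesquilinear_scope.
Local Open Scope complex_scope.

(* R[i] carries no measurable structure in the libraries: its Borel sets are
   the Borel sets of R * R seen through this bijection. *)
Definition reim (R : realType) (z : R[i]) : R * R :=
  (complex.Re z, complex.Im z).

(* Orthonormal bases are unitary matrices: for square matrices [unitarymx]
   is the same condition on rows and on columns. *)
Definition universal_sensing_basis (R : realType) (N : nat)
    (Phi : 'M[R[i]]_N) : Prop :=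
  Phi \is unitarymx /\ forall k i k' i' : 'I_N, `|Phi k i| = `|Phi k' i'|.

Definition sparse (R : realType) (N s : nat) (v : 'cV[R[i]]_N) : Prop :=
  (#|[pred k : 'I_N | v k 0%R != 0%R]| <= s)%N.

(* [complex.Re] is harmless here: `|z| is a real element of R[i]. *)
Definition l1norm (R : realType) (N : nat) (v : 'cV[R[i]]_N) : R :=
  \sum_(k < N) complex.Re `|v k 0|.

Definition minimizer (R : realType) (V : Type) (f : V -> R) (F : set V)
    (x : V) : Prop :=
  F x /\ forall x', F x' -> f x <= f x'.

Definition unique_minimizer (R : realType) (V : Type) (f : V -> R) (F : set V)
    (x : V) : Prop :=
  minimizer f F x /\ forall x', minimizer f F x' -> x' = x.

Section Probability.
Context {d : measure_display} {T : measurableType d} {R : realType}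
  (P : probability T R).

Definition independent_systems (F G : set_system T) : Prop :=
  forall A B, F A -> G B -> P (A `&` B) = (P A * P B)%E.

Definition mutually_independent {d' : measure_display} {U : measurableType d'}
    (n : nat) (X : 'I_n -> T -> U) : Prop :=
  forall (J : {set 'I_n}) (B : 'I_n -> set U),
    (forall i, measurable (B i)) ->
    P (\bigcap_(i in [set` J]) (X i @^-1` B i)) =
    (\prod_(i in J) P (X i @^-1` B i))%E.

Definition uniform_sign (X : T -> R[i]) : Prop :=
  [/\ measurable_fun setT (@reim R \o X),
      P [set w | X w = 1] = (2^-1)%:E &
      P [set w | X w = -1] = (2^-1)%:E].

(* The law of X is the image of the uniform law on [0, 2pi[ under
   t |-> exp(i t). *)
Definition uniform_circle (X : T -> R[i]) : Prop :=
  measurable_fun setT (@reim R \o X) /\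
  forall B : set (R * R), measurable B ->
    P ((@reim R \o X) @^-1` B) =
    (((2 * pi)^-1)%:E *
     lebesgue_measure [set t : R | (0 <= t < 2 * pi)%R /\ B (cos t, sin t)])%E.

Definition rademacher (N : nat) (c : 'I_N -> T -> R[i]) : Prop :=
  (forall k, uniform_sign (c k)) /\
  mutually_independent (fun k => @reim R \o c k).

Definition steinhaus (N : nat) (c : 'I_N -> T -> R[i]) : Prop :=
  (forall k, uniform_circle (c k)) /\
  mutually_independent (fun k => @reim R \o c k).

(* Indices are viewed as nat-valued random variables, nat being equipped with
   its discrete sigma-algebra. *)
Definition index_val (N : nat) (l : T -> 'I_N) : T -> nat :=
  fun w => nat_of_ord (l w).

Definition uniform_indices (N m : nat) (l : 'I_m -> T -> 'I_N) : Prop :=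
  [/\ forall r, measurable_fun setT (index_val (l r)),
      forall r k, P [set w | l r w = k] = (N%:R^-1)%:E &
      mutually_independent (fun r => index_val (l r))].

Definition independent_signs_indices (N m : nat) (c : 'I_N -> T -> R[i])
    (l : 'I_m -> T -> 'I_N) : Prop :=
  independent_systems (g_sigma_preimage (fun k => @reim R \o c k))
                      (g_sigma_preimage (fun r => index_val (l r))).

(* Q itself is not required to be measurable, only to hold on an event of
   probability at least p, in the style of the library's almost-everywhere. *)
Definition with_probability_at_least (p : R) (Q : T -> Prop) : Prop :=
  exists E : set T, [/\ measurable E, (p%:E <= P E)%E & forall w, E w -> Q w].

End Probability.

Section Sensing.
Context {R : realType} {N : nat}.

Definition Ac (Phi Psi : 'M[R[i]]_N) (c : 'I_N -> R[i]) : 'M[R[i]]_N :=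
  Phi ^t* *m diag_mx (\row_k c k) *m Psi.

Definition Ac_rows (m : nat) (Phi Psi : 'M[R[i]]_N) (c : 'I_N -> R[i])
    (l : 'I_m -> 'I_N) : 'M[R[i]]_(m, N) :=
  rowsub l (Ac Phi Psi c).

End Sensing.

(* Main.v *)
(* Write U = Phi^* C Psi; it is unitary because the phases c_k have modulus one.
   An entry of U is a sum of independent centered terms a_i c_i with
   sum |a_i|^2 = 1/N, so a Chernoff bound over c gives |U_jk|^2 <= mu/N for all
   j, k, with mu = O((rho + 2)^2 log^2 N), off an event of probability
   O(N^-rho).  For such a U the sampling of rows is handled by golfing entirely
   in the sup norm: a residual q supported on S = supp alpha with |q| <= b is
   moved close to the row space of a fresh batch of n rows, and the new residual
   is at most b/4 by a Bernstein bound for each coordinate, as soon as n is of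
   order mu s log N.  After L ~ log N batches this gives, for sgn(alpha) and for
   every coordinate vector e_k with k in S, a vector of the row space that is
   within 1/(4N) of it on S and at most 1/3 off S.  The certificates of the e_k
   force |h_S|_1 = O(N) |h_{S^c}|_1 for every h in the kernel, and the
   certificate of sgn(alpha) then shows that alpha + h has larger l1 norm than
   alpha unless h = 0.  In all, m of order s log^4 N rows suffice. *)

Require Import Defs.
From mathcomp Require Import measurable_realfun ring lra.

Set Implicit Arguments.
Unset Strict Implicit.
Unset Printing Implicit Defensive.

Import numFieldNormedType.Exports.

Local Open Scope classical_set_scope.
Local Open Scope ring_scope.
Local Open Scope complex_scope.

(** * The modulus of a complex number *)

Section Complex.
Context {R : realType}.
Implicit Types z w : R[i].
Local Notation Re := complex.Re.
Local Notation Im := complex.Im.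

Definition normc z : R := ComplexField.Normc.normc z.

Lemma normcE z : normc z = Num.sqrt (Re z ^+ 2 + Im z ^+ 2).
Proof. by case: z. Qed.

Lemma Re_norm z : Re `|z| = normc z.
Proof. by rewrite normc_def normcE. Qed.

Lemma normc_ge0 z : 0 <= normc z.
Proof. by rewrite normcE sqrtr_ge0. Qed.

Lemma normcM z w : normc (z * w) = normc z * normc w.
Proof. exact: ComplexField.Normc.normcM. Qed.

Lemma ler_normcD z w : normc (z + w) <= normc z + normc w.
Proof. exact: le_normcD. Qed.

Lemma normcN z : normc (- z) = normc z.
Proof. exact: normcN. Qed.

Lemma normc0 : normc 0 = 0.
Proof. exact: ComplexField.Normc.normc0. Qed.

Lemma normc_eq0 z : normc z = 0 -> z = 0.
Proof. exact: ComplexField.Normc.eq0_normc. Qed.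

Lemma normcJ z : normc z^*%C = normc z.
Proof. by rewrite !normcE; case: z => a b /=; rewrite sqrrN. Qed.

Lemma normc_real (x : R) : normc x%:C = `|x|.
Proof. by rewrite normcE /= expr0n /= addr0 sqrtr_sqr. Qed.

Lemma ler_normc_sum (I : Type) (r : seq I) (p : pred I) (F : I -> R[i]) :
  normc (\sum_(i <- r | p i) F i) <= \sum_(i <- r | p i) normc (F i).
Proof.
elim/big_rec2: _ => [|i x y _ le]; first by rewrite normc0.
by apply: le_trans (ler_normcD _ _) _; rewrite lerD2l.
Qed.

Lemma sqr_normcE z : normc z ^+ 2 = Re z ^+ 2 + Im z ^+ 2.
Proof. by rewrite normcE sqr_sqrtr // addr_ge0 // sqr_ge0. Qed.

Lemma conjcM z w : (z * w)^*%C = z^*%C * w^*%C.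
Proof. exact: (rmorphM (@conjc R)). Qed.

Lemma conjcB z w : (z - w)^*%C = z^*%C - w^*%C.
Proof. exact: (rmorphB (@conjc R)). Qed.

Lemma conjc_sum (I : Type) (r : seq I) (p : pred I) (F : I -> R[i]) :
  (\sum_(i <- r | p i) F i)^*%C = \sum_(i <- r | p i) (F i)^*%C.
Proof. exact: (rmorph_sum (@conjc R)). Qed.

Lemma mulcJ z : z^*%C * z = (normc z ^+ 2)%:C.
Proof.
rewrite sqr_normcE; case: z => a b; apply/eqP; rewrite eq_complex /=.
by apply/andP; split; apply/eqP; ring.
Qed.

Lemma normr_Re z : `|Re z| <= normc z.
Proof. by rewrite normcE -sqrtr_sqr ler_sqrt ?lerDl ?addr_ge0 ?sqr_ge0. Qed.

Lemma normr_Im z : `|Im z| <= normc z.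
Proof. by rewrite normcE -sqrtr_sqr ler_sqrt ?lerDr ?addr_ge0 ?sqr_ge0. Qed.

Lemma normc_le_ReIm z : normc z <= `|Re z| + `|Im z|.
Proof.
have -> : `|Re z| + `|Im z| = Num.sqrt ((`|Re z| + `|Im z|) ^+ 2).
  by rewrite sqrtr_sqr (@ger0_norm _ (_ + _)) ?addr_ge0.
rewrite normcE ler_sqrt ?sqr_ge0 // sqrrD !real_normK ?num_real //.
by rewrite addrAC lerDl mulrn_wge0 // mulr_ge0.
Qed.

Lemma ReD z w : Re (z + w) = Re z + Re w.
Proof. by case: z w => [? ?] []. Qed.

Lemma ImD z w : Im (z + w) = Im z + Im w.
Proof. by case: z w => [? ?] []. Qed.

Lemma ReJ z : Re z^*%C = Re z.
Proof. by case: z. Qed.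

Lemma ImJ z : Im z^*%C = - Im z.
Proof. by case: z. Qed.

Lemma ReM z w : Re (z * w) = Re z * Re w - Im z * Im w.
Proof. by case: z w => [? ?] []. Qed.

Lemma ImM z w : Im (z * w) = Re z * Im w + Im z * Re w.
Proof. by case: z w => [? ?] []. Qed.

Lemma Re_sum (I : Type) (r : seq I) (p : pred I) (F : I -> R[i]) :
  Re (\sum_(i <- r | p i) F i) = \sum_(i <- r | p i) Re (F i).
Proof. by elim/big_rec2: _ => // i x y _ <-; rewrite ReD. Qed.

(** Complex sign, with value 0 at 0, so that the sign pattern of a vector has the same support as
    the vector. *)
Definition sgc z : R[i] := z / (normc z)%:C.

Lemma sgc0 : sgc 0 = 0. Proof. by rewrite /sgc mul0r. Qed.

Lemma normc_sgc_le1 z : normc (sgc z) <= 1.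
Proof.
have [->|z0] := eqVneq z 0; first by rewrite sgc0 normc0.
have nz : normc z != 0 by apply: contra_neq z0 => /normc_eq0.
by rewrite /sgc -fmorphV normcM normc_real ger0_norm ?invr_ge0 ?normc_ge0 // divff.
Qed.

Lemma sgcJ z : (sgc z)^*%C * z = (normc z)%:C.
Proof.
have [->|z0] := eqVneq z 0; first by rewrite mulr0 normc0.
have nz : normc z != 0 by apply: contra_neq z0 => /normc_eq0.
rewrite /sgc -fmorphV conjcM conjc_real mulrAC mulcJ -rmorphM expr2 mulfK //.
Qed.

End Complex.

(** * Recovery from inexact dual certificates *)

Section Recovery.
Context {R : realType} {N : nat}.
Variable S : {set 'I_N}.
Implicit Types (a h q v : 'I_N -> R[i]).

(** Orthogonality to the single vector [h] stands in for membership of [v] in the row space: for [h]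
    in the kernel, this is the only property of the row space that recovery relies on. *)
Definition certificate h q (e : R) := exists v,
  [/\ \sum_k (v k)^*%C * h k = 0,
      (forall k, k \in S -> normc (q k - v k) <= e) &
      forall k, k \notin S -> normc (v k) <= 1 / 3].

(** As [v] is orthogonal to [h], pairing [q] with [h] amounts to pairing [q - v] with [h]; this
    difference is small on [S] and equals [- v] off [S]. *)
Lemma certificate_bound h q e : (forall k, k \notin S -> q k = 0) ->
  certificate h q e ->
  normc (\sum_k (q k)^*%C * h k) <=
    e * (\sum_(k in S) normc (h k)) + 1 / 3 * \sum_(k | k \notin S) normc (h k).
Proof.
move=> q0 [v [v0 vS vSc]].
have -> : \sum_k (q k)^*%C * h k =
    \sum_k ((q k)^*%C * h k - (v k)^*%C * h k) by rewrite sumrB v0 subr0.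
apply: le_trans (ler_normc_sum _ _ _) _.
rewrite (bigID (mem S)) /= !mulr_sumr lerD //; apply: ler_sum => k kS.
  by rewrite -mulrBl normcM -conjcB normcJ ler_wpM2r ?normc_ge0 ?vS.
by rewrite q0 // conjc0 mul0r sub0r normcN normcM normcJ ler_wpM2r ?normc_ge0 ?vSc.
Qed.

(* The certificates of the coordinate vectors play the role of the usual local
   isometry: they bound the part of a kernel vector h on S by its part off S,
   without any estimate on the norm of a random matrix. *)
Lemma certificates_recovery a h (e : R) : 0 <= e -> N%:R * e <= 1 / 4 ->
  (forall k, k \notin S -> a k = 0) ->
  certificate h (fun k => sgc (a k)) e ->
  (forall k, k \in S -> certificate h (fun i => (i == k)%:R) e) ->
  \sum_k normc (a k + h k) <= \sum_k normc (a k) ->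
  forall k, h k = 0.
Proof.
move=> e0 Ne a0 ca ce le.
pose H := \sum_(k in S) normc (h k); pose G := \sum_(k | k \notin S) normc (h k).
have H0 : 0 <= H by apply: sumr_ge0 => *; exact: normc_ge0.
have G0 : 0 <= G by apply: sumr_ge0 => *; exact: normc_ge0.
(* Each coordinate certificate bounds one [|h_k|] with [k] in [S], and [S] has at most [N]
   elements. *)
have HG : H <= N%:R * (e * H + 1 / 3 * G).
  have hk k : k \in S -> normc (h k) <= e * H + 1 / 3 * G.
    move=> kS; have := certificate_bound _ (ce k kS).
    rewrite (bigD1 k) //= eqxx conjc1 (mul1r (h k)) big1 ?addr0; last first.
      by move=> i /negPf ->; rewrite conjc0 mul0r.
    apply => i iS; case: eqVneq => // ik; by rewrite ik kS in iS.
  apply: le_trans (ler_sum _ hk) _; rewrite sumr_const -[leLHS]mulr_natl.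
  rewrite ler_wpM2r ?ler_nat ?addr_ge0 ?mulr_ge0 //.
  by rewrite -[X in (_ <= X)%N](card_ord N) max_card.
have key : G <= e * H + 1 / 3 * G.
  have b := certificate_bound (q := fun k => sgc (a k)) _ ca.
  have {}b := b (fun k kS => etrans (congr1 sgc (a0 k kS)) sgc0).
  apply: le_trans (b).
  (* On [S], [|a_k + h_k|] dominates the real part of its product with the conjugate sign of [a_k];
     off [S], [a_k] vanishes. *)
  have h1 : \sum_k (normc (a k) + complex.Re ((sgc (a k))^*%C * h k)) + G <=
            \sum_k normc (a k + h k).
    rewrite (bigID (mem S)) /= [X in _ + X + _]big1 ?addr0; last first.
      by move=> k /a0 ->; rewrite sgc0 normc0 conjc0 mul0r addr0.
    rewrite [leRHS](bigID (mem S)) /=; apply: lerD; last first.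
      by apply: ler_sum => k /a0 ->; rewrite add0r.
    apply: ler_sum => k _.
    have -> : normc (a k) + complex.Re ((sgc (a k))^*%C * h k) =
        complex.Re ((sgc (a k))^*%C * (a k + h k)).
      by rewrite mulrDr ReD sgcJ.
    apply: le_trans (ler_norm _) _; apply: le_trans (normr_Re _) _.
    by rewrite normcM normcJ ler_piMl ?normc_ge0 ?normc_sgc_le1.
  have := le_trans h1 le; rewrite big_split /= -Re_sum -addrA gerDl.
  set z := \sum_(i < N) _ => h2.
  apply: le_trans (normr_Re _); rewrite -normrN.
  apply: le_trans (ler_norm _); lra.
(* As [N e <= 1/4], [HG] multiplied by [e] gives [e H <= (e H + G / 3) / 4], that is [e H <= G / 9];
   then [key] reads [G <= 4 G / 9]. *)
have G00 : G = 0.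
  have : e * H <= 1 / 9 * G by nra.
  lra.
have H00 : H = 0.
  have : N%:R * e * H <= 1 / 4 * H by rewrite ler_wpM2r.
  move: HG; rewrite G00 mulr0 addr0 mulrA; lra.
move=> k; apply: normc_eq0; case: (boolP (k \in S)) => kS.
  exact: (psumr_eq0P (fun i _ => normc_ge0 (h i)) H00).
exact: (psumr_eq0P (fun i _ => normc_ge0 (h i)) G00).
Qed.

End Recovery.

(** * Uniformly sampled sequences of indices *)

(** Multiply [1 - x <= expR (- x)] by the quadratic: the product [(1 + x + 2 x^2) (1 - x) = 1 + x^2
    (1 - 2 x)] is at least 1 as soon as [x <= 1/2]. *)
Lemma expR_le_quadratic (R : realType) (x : R) : x <= 1 / 2 ->
  expR x <= 1 + x + 2 * x ^+ 2.
Proof.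
move=> x2; have h : 1 - x <= expR (- x) by exact: expR_ge1Dx.
have q0 : 0 <= 1 + x + 2 * x ^+ 2 by nra.
have p1 : 1 <= (1 + x + 2 * x ^+ 2) * (1 - x) by nra.
rewrite -[expR x]mul1r; apply: le_trans (ler_wpM2r (expR_ge0 x) p1) _.
rewrite -mulrA ler_piMr //.
by apply: le_trans (ler_wpM2r (expR_ge0 x) h) _; rewrite -expRD addNr expR0.
Qed.

Section Avg.
Context {R : realType} {N : nat}.
Hypothesis N0 : (0 < N)%N.
Implicit Types (F G : seq 'I_N -> R) (n k : nat) (f g : 'I_N -> R).

(* Mean of F over the uniform law on n-sequences of indices; the recursive form
   makes conditioning on a prefix (lemma [avg_cat]) immediate. *)
Fixpoint avg n F : R :=
  if n is n'.+1 then N%:R^-1 * \sum_j avg n' (fun s => F (j :: s)) else F [::].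

Let Ninv0 : 0 <= N%:R^-1 :> R. Proof. by rewrite invr_ge0. Qed.

Lemma ler_avg n F G : (forall s, size s = n -> F s <= G s) -> avg n F <= avg n G.
Proof.
elim: n F G => [|n IH] F G FG /=; first exact: FG.
by rewrite ler_wpM2l // ler_sum // => j _; apply: IH => s sn; apply: FG; rewrite /= sn.
Qed.

Lemma eq_avg n F G : (forall s, size s = n -> F s = G s) -> avg n F = avg n G.
Proof.
by move=> FG; apply/eqP; rewrite eq_le !ler_avg // => s sn; rewrite FG.
Qed.

Lemma avgD n F G : avg n (fun s => F s + G s) = avg n F + avg n G.
Proof.
elim: n F G => [|n IH] F G //=.
by under eq_bigr do rewrite IH; rewrite big_split mulrDr.
Qed.

Lemma avgZ n (a : R) F : avg n (fun s => a * F s) = a * avg n F.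
Proof.
elim: n F => [|n IH] F //=.
by under eq_bigr do rewrite IH; rewrite -mulr_sumr mulrCA.
Qed.

Lemma avg_cst n (a : R) : avg n (fun=> a) = a.
Proof.
elim: n => [|n IH] //=; under eq_bigr do rewrite IH.
by rewrite sumr_const card_ord -(mulr_natl a) mulKf // pnatr_eq0 -lt0n.
Qed.

Lemma avg_sum (I : Type) (r : seq I) n (F : I -> seq 'I_N -> R) :
  avg n (fun s => \sum_(i <- r) F i s) = \sum_(i <- r) avg n (F i).
Proof.
elim: r => [|i r IH].
  by rewrite big_nil -[RHS](avg_cst n); apply: eq_avg => s _; rewrite big_nil.
by rewrite big_cons -IH -avgD; apply: eq_avg => s _; rewrite big_cons.
Qed.

Lemma avg_cat n k F :
  avg (n + k) F = avg n (fun s => avg k (fun t => F (s ++ t))).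
Proof.
elim: n F => [|n IH] F //=.
by congr (_ * _); apply: eq_bigr => j _; rewrite IH.
Qed.

Lemma avg_prod n f :
  avg n (fun s => \prod_(j <- s) f j) = (N%:R^-1 * \sum_j f j) ^+ n.
Proof.
elim: n => [|n IH] /=; first by rewrite big_nil.
rewrite exprS -IH -mulrA; congr (_ * _); rewrite mulr_suml; apply: eq_bigr => j _.
by rewrite -avgZ; apply: eq_avg => s _; rewrite big_cons.
Qed.

(** Links the recursive mean to a sum over tuples, the form in which the law of the sampled rows
    appears. *)
Lemma avg_tuple n F : avg n F = N%:R ^- n * \sum_(t : n.-tuple 'I_N) F t.
Proof.
elim: n F => [|n IH] F /=.
  rewrite expr0 invr1 mul1r (bigD1 [tuple]) //= big1 ?addr0 // => t.
  by case/eqP; apply: tuple0.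
under eq_bigr do rewrite IH.
rewrite -mulr_sumr mulrA exprS invfM; congr (_ * _).
rewrite pair_bigA /= (reindex (fun t : n.+1.-tuple 'I_N => (thead t, [tuple of behead t]))) /=.
  by apply: eq_bigr => t _; rewrite [in RHS](tuple_eta t).
exists (fun p : 'I_N * n.-tuple 'I_N => [tuple of p.1 :: p.2]) => [t _|[j t] _] /=.
  by rewrite -tuple_eta.
by congr (_, _); apply: val_inj.
Qed.

(** Exponential Markov inequality. By [avg_prod] the mean of the exponential is a power of a
    one-draw mean, whose linear term vanishes because [f] is centred, leaving [1 + 2 lam^2 V]. *)
Lemma avg_chernoff n f (lam V a : R) :
  (forall j, lam * f j <= 1 / 2) -> \sum_j f j = 0 ->
  N%:R^-1 * \sum_j f j ^+ 2 <= V -> 0 <= lam ->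
  avg n (fun s => (a < \sum_(j <- s) f j)%R%:R) <=
    expR (2 * lam ^+ 2 * V *+ n - lam * a).
Proof.
move=> fB f0 fV lam0.
have -> : expR (2 * lam ^+ 2 * V *+ n - lam * a) =
          expR (- (lam * a)) * expR (2 * lam ^+ 2 * V) ^+ n.
  by rewrite addrC expRD -[_ *+ n]mulr_natl expRM_natl.
apply: (@le_trans _ _ (avg n (fun s => expR (- (lam * a)) * \prod_(j <- s) expR (lam * f j)))).
  apply: ler_avg => s _.
  have -> : \prod_(j <- s) expR (lam * f j) = expR (lam * \sum_(j <- s) f j).
    by rewrite mulr_sumr expR_sum.
  rewrite -expRD; case: ltP => h /=; last exact: expR_ge0.
  by rewrite -expR0 ler_expR addrC -mulrBr mulr_ge0 // subr_ge0 ltW.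
rewrite avgZ avg_prod ler_wpM2l ?expR_ge0 // lerXn2r ?nnegrE ?expR_ge0 //.
  by rewrite mulr_ge0 // sumr_ge0 // => j _; exact: expR_ge0.
apply: (@le_trans _ _ (1 + 2 * lam ^+ 2 * V)); last exact: expR_ge1Dx.
apply: (@le_trans _ _ (N%:R^-1 * \sum_j (1 + lam * f j + 2 * lam ^+ 2 * f j ^+ 2))).
  rewrite ler_wpM2l // ler_sum // => j _.
  by apply: le_trans (expR_le_quadratic (fB j)) _; rewrite exprMn mulrA.
rewrite !big_split /= -!mulr_sumr f0 mulr0 addr0 sumr_const card_ord mulrDr.
rewrite mulVf ?pnatr_eq0 -?lt0n //.
by rewrite lerD2l mulrCA ler_wpM2l // mulr_ge0 ?sqr_ge0.
Qed.

End Avg.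

(** * The golfing scheme in the sup norm *)

Section Golfing.
Context {R : realType} {N : nat}.
Hypothesis N0 : (0 < N)%N.
Variables (U : 'I_N -> 'I_N -> R[i]) (S : {set 'I_N}) (n : nat).
Hypothesis n0 : (0 < n)%N.
Implicit Types (q h : 'I_N -> R[i]) (s : seq 'I_N) (b : R) (z : R[i]).
Local Notation Re := complex.Re.
Local Notation Im := complex.Im.

Definition inner q j : R[i] := \sum_i U j i * q i.

(* A batch of n sampled rows: N/n times the Gram operator of these rows, whose
   mean is the identity when U is unitary. *)
Definition frame s q k : R[i] :=
  (N%:R / n%:R : R)%:C * \sum_(j <- s) (U j k)^*%C * inner q j.

Definition small b z := (`|Re z| <= b) && (`|Im z| <= b).

(** A bound [b / 8] on both real and imaginary parts gives modulus at most [b / 4]. All [k] are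
    included: on [S] this shrinks the residual, off [S] it keeps the certificate small. *)
Definition concentrated b q s :=
  [forall k, small (b / 8) (frame s q k - q k)].

(** Cutting the new residual to [S] keeps it sparse, on which the variance bound for the next batch
    rests. *)
Definition golf_step q s k := if k \in S then q k - frame s q k else 0.

(* b bounds the sup norm of the current residual q, which each batch of n rows
   shrinks by a factor 4; the indices beyond the first L batches are ignored. *)
Fixpoint golf_ok L b q s : bool :=
  if L is L'.+1 then
    concentrated b q (take n s) &&
    golf_ok L' (b / 4) (golf_step q (take n s)) (drop n s)
  else true.

(* Reduces complex deviations to one-sided real ones. *)
Definition direction (p : bool * bool) z : R :=
  (-1) ^+ p.1 * (if p.2 then Re z else Im z).

Lemma directionD p z w : direction p (z + w) = direction p z + direction p w.
Proof. by rewrite /direction; case: p.2; rewrite ?ReD ?ImD mulrDr. Qed.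

Lemma directionZ p (x : R) z : direction p (x%:C * z) = x * direction p z.
Proof.
by rewrite /direction; case: p.2; rewrite ?ReM ?ImM /=; ring.
Qed.

Lemma direction_sum p (I : Type) (r : seq I) (F : I -> R[i]) :
  direction p (\sum_(i <- r) F i) = \sum_(i <- r) direction p (F i).
Proof.
elim: r => [|i r IH]; last by rewrite !big_cons directionD IH.
by rewrite !big_nil /direction; case: p.2; rewrite mulr0.
Qed.

Lemma normr_direction p z : `|direction p z| <= normc z.
Proof.
rewrite /direction normrM normrX normrN1 expr1n mul1r.
by case: p.2; rewrite (normr_Re, normr_Im).
Qed.

Lemma not_small b z : ~~ small b z -> exists p, b < direction p z.
Proof.
rewrite /small negb_and -!ltNge !ltr_normr => /orP[] /orP[] h.
- by exists (false, true); rewrite /direction expr0 mul1r.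
- by exists (true, true); rewrite /direction expr1 mulN1r.
- by exists (false, false); rewrite /direction expr0 mul1r.
- by exists (true, false); rewrite /direction expr1 mulN1r.
Qed.

Lemma small_normc b z : small (b / 8) z -> normc z <= b / 4.
Proof. by move=> /andP[h1 h2]; apply: le_trans (normc_le_ReIm z) _; lra. Qed.

(** The certificate is the sum of the frame vectors of the successive residuals. Each combines
    conjugates of sampled rows, which annihilate [h]. On [S] the error telescopes to the last
    residual; off [S] the induction closes because [b / 4 + (b / 4) / 3 = b / 3]. *)
Lemma golf_certificate h L b q s :
  (forall j, j \in s -> inner h j = 0) ->
  0 <= b -> (forall k, k \notin S -> q k = 0) -> (forall k, normc (q k) <= b) ->
  golf_ok L b q s ->
  exists v, [/\ \sum_k (v k)^*%C * h k = 0,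
    (forall k, k \in S -> normc (q k - v k) <= b / 4 ^+ L) &
    forall k, k \notin S -> normc (v k) <= b / 3].
Proof.
elim: L b q s => [|L IH] b q s hs b0 q0 qb /=.
  move=> _; exists (fun=> 0); split.
  - by rewrite big1 // => k _; rewrite conjc0 mul0r.
  - by move=> k _; rewrite subr0 expr0 divr1.
  - by move=> k _; rewrite normc0 divr_ge0.
move=> /andP[/forallP con /IH].
have bq k : normc (frame (take n s) q k - q k) <= b / 4 by exact: small_normc.
case.
- by move=> j /mem_drop /hs.
- by rewrite divr_ge0.
- by move=> k /negPf kS; rewrite /golf_step kS.
- move=> k; rewrite /golf_step; case: ifP => _; last by rewrite normc0 divr_ge0.
  by rewrite -normcN opprB.
move=> v [vh vS vSc]; exists (fun k => frame (take n s) q k + v k); split.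
- under eq_bigr do rewrite rmorphD mulrDl.
  rewrite big_split /= vh addr0 /frame.

  under eq_bigr do rewrite conjcM conjc_sum -mulrA mulr_suml.
  rewrite -mulr_sumr exchange_big /= big_seq big1 ?mulr0 // => j jS.
  under eq_bigr do rewrite conjcM conjcK mulrAC.
  by rewrite -mulr_suml -/(inner h j) (hs _ (mem_take jS)) mul0r.
- move=> k kS; have := vS k kS; rewrite /golf_step kS.
  by rewrite opprD addrA exprS invfM mulrA.
- move=> k kS; apply: le_trans (ler_normcD _ _) _.
  have := vSc k kS; have := bq k; rewrite q0 // subr0; lra.
Qed.

Variables (mu : R) (s : R).
Hypothesis mu1 : 1 <= mu.
Hypothesis s1 : 1 <= s.
Hypothesis Ss : #|S|%:R <= s.
Hypothesis orthoU : forall k i, \sum_j (U j k)^*%C * U j i = (k == i)%:R.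
Hypothesis cohU : forall j k, normc (U j k) ^+ 2 <= mu / N%:R.

Lemma inner_adjoint q k : \sum_j (U j k)^*%C * inner q j = q k.
Proof.
under eq_bigr do rewrite mulr_sumr.
rewrite exchange_big (bigD1 k) //= [X in _ + X]big1 => [|i ik].
  by under eq_bigr do rewrite mulrA; rewrite -mulr_suml orthoU eqxx mul1r addr0.
by under eq_bigr do rewrite mulrA; rewrite -mulr_suml orthoU eq_sym (negPf ik) mul0r.
Qed.

Lemma inner_parseval q : \sum_j normc (inner q j) ^+ 2 = \sum_i normc (q i) ^+ 2.
Proof.
apply: complexI; rewrite !rmorph_sum /=.
under eq_bigr do rewrite -mulcJ.
under [RHS]eq_bigr do rewrite -mulcJ.
under eq_bigr do rewrite {1}/inner conjc_sum mulr_suml.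
rewrite exchange_big /=; apply: eq_bigr => i _.
rewrite -[X in _ = _ * X]inner_adjoint mulr_sumr; apply: eq_bigr => j _.
by rewrite conjcM -mulrA mulrCA.
Qed.

Let N1 : 0 < N%:R :> R. Proof. by rewrite ltr0n. Qed.

Lemma normc_coherent j k : normc (U j k) <= Num.sqrt (mu / N%:R).
Proof.
by rewrite -(ger0_norm (normc_ge0 _)) -sqrtr_sqr ler_wsqrtr.
Qed.

Lemma normc_inner b q j : 0 <= b -> (forall k, k \notin S -> q k = 0) ->
  (forall k, normc (q k) <= b) ->
  normc (inner q j) <= s * (Num.sqrt (mu / N%:R) * b).
Proof.
move=> b0 q0 qb; rewrite /inner (bigID (mem S)) /= [X in _ + X]big1 ?addr0; last first.
  by move=> k /q0 ->; rewrite mulr0.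
apply: le_trans (ler_normc_sum _ _ _) _.
apply: (@le_trans _ _ (\sum_(i in S) Num.sqrt (mu / N%:R) * b)).
  by apply: ler_sum => i _; rewrite normcM ler_pM ?normc_ge0 ?normc_coherent.
rewrite sumr_const -[leLHS]mulr_natl ler_wpM2r // mulr_ge0 ?sqrtr_ge0 //.
Qed.

Lemma sumr_normc_sqr b q : 0 <= b -> (forall k, k \notin S -> q k = 0) ->
  (forall k, normc (q k) <= b) -> \sum_i normc (q i) ^+ 2 <= s * b ^+ 2.
Proof.
move=> b0 q0 qb; rewrite (bigID (mem S)) /= [X in _ + X]big1 ?addr0; last first.
  by move=> k /q0 ->; rewrite normc0 expr0n.
apply: (@le_trans _ _ (\sum_(i in S) b ^+ 2)).
  by apply: ler_sum => i _; rewrite lerXn2r ?nnegrE ?normc_ge0.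
by rewrite sumr_const -[leLHS]mulr_natl ler_wpM2r // sqr_ge0.
Qed.

Definition deviation q k j : R[i] := N%:R%:C * ((U j k)^*%C * inner q j) - q k.

Lemma sum_deviation q k : \sum_j deviation q k j = 0.
Proof.
rewrite big_split /= -mulr_sumr inner_adjoint sumr_const card_ord.
by rewrite -[X in _ + X]mulr_natl rmorph_nat mulrN subrr.
Qed.

Lemma frame_deviation q k t : size t = n ->
  frame t q k - q k = (n%:R^-1)%:C * \sum_(j <- t) deviation q k j.
Proof.
move=> tn; rewrite /deviation big_split /= mulrDr -mulr_sumr mulrA -rmorphM /=.
rewrite /frame [n%:R^-1 * _]mulrC; congr (_ + _).
rewrite big_const_seq count_predT tn iter_addr_0 -[X in _ * X]mulr_natl mulrA.
rewrite fmorphV rmorph_nat mulVf ?mul1r //.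
by rewrite pnatr_eq0 -lt0n.
Qed.

(** The entry of [U] and the inner product each contribute a factor [sqrt (mu / N)], which together
    with the scaling by [N] makes [mu]. *)
Lemma normc_deviation b q k j : 0 <= b -> (forall k, k \notin S -> q k = 0) ->
  (forall k, normc (q k) <= b) -> normc (deviation q k j) <= 2 * mu * s * b.
Proof.
move=> b0 q0 qb; apply: le_trans (ler_normcD _ _) _.
rewrite normcN !normcM normcJ normc_real ger0_norm ?ler0n //.
have h1 : N%:R * (normc (U j k) * normc (inner q j)) <= mu * s * b.
  have -> : mu * s * b = N%:R * (Num.sqrt (mu / N%:R) * (s * (Num.sqrt (mu / N%:R) * b))).
    have sq : Num.sqrt (mu / N%:R) * Num.sqrt (mu / N%:R) = mu / N%:R.
      by rewrite -expr2 sqr_sqrtr // divr_ge0 // ?(le_trans ler01).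
    transitivity (N%:R * (s * b * (Num.sqrt (mu / N%:R) * Num.sqrt (mu / N%:R)))).
      by rewrite sq; field; rewrite gt_eqF.
    by ring.
  by rewrite ler_wpM2l ?ler_pM ?normc_ge0 ?normc_coherent ?normc_inner.
have h2 : b <= mu * s * b by rewrite ler_peMl // mulr_ege1.
by apply: le_trans (lerD h1 (le_trans (qb k) h2)) _; lra.
Qed.

(** One factor is bounded by coherence, but the inner products are summed by Parseval. This saves a
    factor [mu s] over the square of the bound in [normc_deviation], and makes the batch size linear
    in [s]. *)
Lemma sum_sqr_deviation b q k : 0 <= b -> (forall k, k \notin S -> q k = 0) ->
  (forall k, normc (q k) <= b) ->
  N%:R^-1 * \sum_j normc (deviation q k j) ^+ 2 <= 4 * mu * s * b ^+ 2.
Proof.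
move=> b0 q0 qb.
have h j : normc (deviation q k j) ^+ 2 <=
    2 * (N%:R * mu * normc (inner q j) ^+ 2) + 2 * b ^+ 2.
  apply: (@le_trans _ _ ((N%:R * (normc (U j k) * normc (inner q j)) + b) ^+ 2)).
    rewrite lerXn2r ?nnegrE ?normc_ge0 //.
      by rewrite addr_ge0 // !mulr_ge0 ?normc_ge0.
    apply: le_trans (ler_normcD _ _) _.
    by rewrite normcN !normcM normcJ normc_real ger0_norm ?ler0n // lerD2l.
  have : (N%:R * (normc (U j k) * normc (inner q j))) ^+ 2 <=
         N%:R * mu * normc (inner q j) ^+ 2.
    rewrite !exprMn mulrA ler_wpM2r ?sqr_ge0 //.
    apply: le_trans (ler_wpM2l (sqr_ge0 _) (cohU j k)) _.
    by rewrite expr2 -mulrA ler_wpM2l // mulrCA mulfV ?mulr1 // gt_eqF.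
  move: (N%:R * (_ * _)) (N%:R * _ * _) => x y xy.
  have := sqr_ge0 (x - b); rewrite sqrrB sqrrD; lra.
apply: le_trans (ler_wpM2l _ (ler_sum _ (fun j _ => h j))) _; first by rewrite invr_ge0 ltW.
rewrite big_split /= sumr_const card_ord -!mulr_sumr inner_parseval.
rewrite -[2 * b ^+ 2 *+ N]mulr_natl.
have -> (x y : R) : N%:R^-1 * (2 * (N%:R * mu * x) + N%:R * y) = 2 * (mu * x) + y.
  by field; rewrite gt_eqF.
have h1 := ler_wpM2l (le_trans ler01 mu1) (sumr_normc_sqr b0 q0 qb).
have h2 : b ^+ 2 <= mu * (s * b ^+ 2).
  by rewrite mulrA ler_peMl ?sqr_ge0 // mulr_ege1.
lra.
Qed.

(** Union bound over the [N] coordinates and the four directions, with [avg_chernoff] for each. *)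
Lemma concentration_fail b q : 0 < b -> (forall k, k \notin S -> q k = 0) ->
  (forall k, normc (q k) <= b) ->
  avg n (fun t => (~~ concentrated b q t)%:R) <=
    4 * N%:R * expR (- (n%:R / (2048 * mu * s))).
Proof.
move=> b0 q0 qb; have b0' := ltW b0.
have mu0 : 0 < mu by rewrite (lt_le_trans ltr01).
have s0 : 0 < s by rewrite (lt_le_trans ltr01).
have nR : 0 < n%:R :> R by rewrite ltr0n.
pose f p k j := direction p (deviation q k j).
apply: (@le_trans _ _ (avg n (fun t => \sum_(k : 'I_N) \sum_(p : bool * bool)
    (n%:R * (b / 8) < \sum_(j <- t) f p k j)%R%:R))).
  apply: ler_avg => // t tn; case: (boolP (concentrated _ _ _)) => [_|].
    by rewrite sumr_ge0 // => k _; apply: sumr_ge0.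
  rewrite negb_forall => /existsP[k /not_small [p]].
  rewrite frame_deviation // directionZ direction_sum => h.
  rewrite (bigD1 k) // (bigD1 p) //= /f.
  rewrite [n%:R^-1 * _]mulrC ltr_pdivlMr // [b / 8 * _]mulrC in h; rewrite h.
  by rewrite -addrA lerDl addr_ge0 // sumr_ge0 // => *; apply: sumr_ge0.
rewrite avg_sum //.
under eq_bigr do rewrite avg_sum //.
set e := expR _.
apply: (@le_trans _ _ (\sum_(k : 'I_N) \sum_(p : bool * bool) e)); last first.
  rewrite !sumr_const card_ord card_prod card_bool -mulrnA -[leLHS]mulr_natl.
  by rewrite natrM.
apply: ler_sum => k _; apply: ler_sum => p _.
(* This [lam] minimizes [2 lam^2 V n - lam n b / 8] for [V = 4 mu s b^2], with minimum exactly
   [- n / (2048 mu s)]; it also gives [lam |f| <= 1/64]. *)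
apply: le_trans
  (avg_chernoff N0 n (lam := (128 * mu * s * b)^-1) _ (V := 4 * mu * s * b ^+ 2) _ _ _ _) _.
- move=> j; rewrite mulrC ler_pdivrMr ?mulr_gt0 //.
  apply: le_trans (ler_norm _) _; apply: le_trans (normr_direction _ _) _.
  apply: le_trans (normc_deviation _ _ b0' q0 qb) _.
  have : 0 <= mu * s * b by rewrite !mulr_ge0 // ltW.
  lra.
- rewrite -direction_sum sum_deviation /direction.
  by case: (p.2); rewrite mulr0.
- apply: le_trans (sum_sqr_deviation k b0' q0 qb).
  rewrite ler_wpM2l ?invr_ge0 // ler_sum // => j _.
  by rewrite -real_normK ?num_real // lerXn2r ?nnegrE ?normc_ge0 ?normr_direction.
- by rewrite invr_ge0 !mulr_ge0 // ltW.
rewrite ler_expR -mulr_natl le_eqVlt; apply/orP; left; apply/eqP.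
by field; rewrite !gt_eqF.
Qed.

(** Condition on the first batch by [avg_cat]. If it is bad, the inner mean is at most 1 and is
    charged to [concentration_fail]; if it is good, the residual is a fixed vector bounded by
    [b / 4] and the remaining rows are fresh. The [r] spare rows absorb the remainder of a division
    by [L]. *)
Lemma golf_fail L r b q : 0 < b -> (forall k, k \notin S -> q k = 0) ->
  (forall k, normc (q k) <= b) ->
  avg (L * n + r) (fun t => (~~ golf_ok L b q t)%:R) <=
    L%:R * (4 * N%:R * expR (- (n%:R / (2048 * mu * s)))).
Proof.
elim: L b q => [|L IH] b q b0 q0 qb.
  by rewrite mul0r -[leRHS](avg_cst N0 (0 * n + r)).
rewrite mulSn -addnA avg_cat -natr1 mulrDl mul1r addrC.
apply: le_trans (lerD (concentration_fail b0 q0 qb) (lexx _)).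
rewrite -[X in _ + X](avg_cst N0 n) -avgD; apply: ler_avg => t tn /=.
have [con|ncon] := boolP (concentrated b q t); last first.
  apply: (@le_trans _ _ (avg (L * n + r) (fun=> 1))).
    by apply: ler_avg => t' _; rewrite lern1 leq_b1.
  rewrite (avg_cst N0).
  rewrite -[leLHS]addr0.
  apply: lerD; first exact: lexx.
  apply: mulr_ge0; first exact: ler0n.
  by apply: mulr_ge0; [exact: mulr_ge0 | exact: expR_ge0].
rewrite add0r; apply: le_trans (IH (b / 4) (golf_step q t) _ _ _).
- apply: ler_avg => t' _.
  by rewrite take_size_cat // drop_size_cat // con.
- by rewrite divr_gt0.
- by move=> k /negPf kS; rewrite /golf_step kS.
- move=> k; rewrite /golf_step; case: ifP => _; last by rewrite normc0 divr_ge0 // ltW.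
  by rewrite -normcN opprB; apply: small_normc; move/forallP: con.
Qed.

Definition golf_success L (a : 'I_N -> R[i]) t :=
  golf_ok L 1 (fun k => sgc (a k)) t &&
  [forall k in S, golf_ok L 1 (fun i => (i == k)%:R) t].

(** The sign pattern and the coordinate vectors are all golfed on the same rows; a union bound over
    them costs the factor [1 + N]. *)
Lemma golf_success_fail L r (a : 'I_N -> R[i]) : (forall k, k \notin S -> a k = 0) ->
  avg (L * n + r) (fun t => (~~ golf_success L a t)%:R) <=
    (1 + N%:R) * (L%:R * (4 * N%:R * expR (- (n%:R / (2048 * mu * s))))).
Proof.
move=> a0; set e := L%:R * _.
have e0 : 0 <= e.
  apply: mulr_ge0; first exact: ler0n.
  by apply: mulr_ge0; [exact: mulr_ge0 | exact: expR_ge0].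
apply: (@le_trans _ _ (avg (L * n + r) (fun t => (~~ golf_ok L 1 (fun k => sgc (a k)) t)%:R +
   \sum_k ((k \in S) && ~~ golf_ok L 1 (fun i => (i == k)%:R) t)%:R))).
  apply: ler_avg => // t _; rewrite /golf_success negb_and.
  case: golf_ok => /=; last by rewrite lerDl sumr_ge0.
  rewrite add0r; case: (boolP [forall _ in _, _]) => [_|]; first by rewrite sumr_ge0.
  rewrite negb_forall_in => /existsP[k] h.
  by rewrite (bigD1 k) //= h lerDl sumr_ge0.
rewrite avgD mulrDl mul1r lerD //.
  apply: golf_fail => // [k /a0 ->|k]; [exact: sgc0 | exact: normc_sgc_le1].
have -> : N%:R * e = \sum_(k < N) e by rewrite sumr_const card_ord mulr_natl.
rewrite avg_sum //.
apply: ler_sum => k _; case: (boolP (k \in S)) => kS /=; last by rewrite avg_cst.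
apply: golf_fail => // [i iS|i].
  by case: eqVneq => // ik; rewrite ik kS in iS.
by case: eqVneq; rewrite ?normc0 // (_ : (true%:R : R[i]) = 1%:C) // normc_real normr1.
Qed.

(** Starting from [b = 1], golfing delivers exactly the certificates of [certificates_recovery] with
    [e = 1 / 4 ^ L]. *)
Lemma golf_success_recovery L (a h : 'I_N -> R[i]) t :
  (N%:R / 4 ^+ L <= 1 / 4 :> R) -> (forall k, k \notin S -> a k = 0) ->
  golf_success L a t -> (forall j, j \in t -> inner h j = 0) ->
  \sum_k normc (a k + h k) <= \sum_k normc (a k) -> forall k, h k = 0.
Proof.
move=> NL a0 /andP[oka /forall_inP okS] ht le.
apply: (@certificates_recovery _ _ S a h (1 / 4 ^+ L)) => //.
- by rewrite mulrA mulr1.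
- apply: golf_certificate ht _ _ _ oka => // [k /a0 ->|k].
    exact: sgc0.
  exact: normc_sgc_le1.
- move=> k kS; apply: golf_certificate ht _ _ _ (okS k kS) => // [i iS|i].
    by case: eqVneq => // ik; rewrite ik kS in iS.
  by case: eqVneq; rewrite ?normc0 // (_ : (true%:R : R[i]) = 1%:C) // normc_real normr1.
Qed.

End Golfing.

(** * Independent phases *)

Section WeightedLaws.
Import HBNNSimple.

Section Approximation.
Local Open Scope ereal_scope.
Context {d : measure_display} {T : measurableType d} {R : realType}
  (mu : {measure set T -> \bar R})
  {d' : measure_display} {U : measurableType d'} (X : T -> U) (Z : T -> R).
Hypotheses (mX : measurable_fun setT X) (mZ : measurable_fun setT Z)
  (Z0 : forall w, (0 <= Z w)%R).
Let mZE : measurable_fun setT (EFin \o Z). Proof. exact/measurable_EFinP. Qed.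
Variable g : U -> R.
Hypotheses (mg : measurable_fun setT g) (g0 : forall u, (0 <= g u)%R).

Let mgE : measurable_fun setT (EFin \o g). Proof. exact/measurable_EFinP. Qed.
Let h := nnsfun_approx measurableT mgE.

(** Monotone convergence along simple approximations of [g]: the right-hand side depends on [X] and
    [Z] only through weighted integrals of indicators, so two weighted laws can be compared on
    those. *)
Lemma integral_weight_approx :
  \int[mu]_w ((Z w)%:E * (g (X w))%:E) =
  limn (fun n => \sum_(k \in range (h n)) k%:E *
     \int[mu]_w ((Z w)%:E * (\1_(h n @^-1` [set k]) (X w))%:E)).
Proof.
transitivity (limn (fun n => \int[mu]_w ((Z w)%:E * (h n (X w))%:E))).
  rewrite -monotone_convergence//.
  - apply: eq_integral => w _; apply/esym/cvg_lim => //.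
    apply: cvgeZl => //.
    by apply: cvg_nnsfun_approx => // u _; rewrite lee_fin.
  - move=> n; apply: emeasurable_funM => //; apply/measurable_EFinP.
    exact: measurableT_comp.
  - by move=> n w _; rewrite mule_ge0 ?lee_fin.
  - by move=> w _ m n mn; rewrite lee_wpmul2l ?lee_fin //; exact/lefP/nd_nnsfun_approx.
congr (limn _); apply/funext => n.
have mI k : measurable_fun setT (fun w => (\1_(h n @^-1` [set k]) (X w))%:E : \bar R).
  apply/measurable_EFinP; apply: measurableT_comp => //.
transitivity (\sum_(k \in range (h n))
    \int[mu]_w (k%:E * ((Z w)%:E * (\1_(h n @^-1` [set k]) (X w))%:E))).
  rewrite -ge0_integral_fsum//.
  - apply: eq_integral => w _; rewrite [in LHS]fimfunE -fsumEFin// ge0_mule_fsumr.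
      by apply: eq_fsbigr => k _; rewrite EFinM muleCA.
    by move=> k; exact: nnfun_muleindic_ge0.
  - move=> k; apply: emeasurable_funM => //; exact: emeasurable_funM.
  - move=> k w _; rewrite muleCA; apply: mule_ge0; first by rewrite lee_fin.
    exact: (nnfun_muleindic_ge0 (h n) k (X w)).
apply: eq_fsbigr => k; rewrite inE => -[u _ <-].
rewrite ge0_integralZl// ?lee_fin//; first exact: emeasurable_funM.
by move=> w _; rewrite mule_ge0// lee_fin.
Qed.

End Approximation.

(* Used with Z2 constant to peel one factor off a product of independent
   variables, and with Z2 the uniform density on [0, 2pi[ to compute with the law
   of a Steinhaus variable. *)
Lemma integral_weight_law (R : realType)
    d1 (T1 : measurableType d1) (mu1 : {measure set T1 -> \bar R})
    d2 (T2 : measurableType d2) (mu2 : {measure set T2 -> \bar R})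
    d' (U : measurableType d') (X1 : T1 -> U) (X2 : T2 -> U)
    (Z1 : T1 -> R) (Z2 : T2 -> R) (g : U -> R) :
  measurable_fun setT X1 -> measurable_fun setT X2 ->
  measurable_fun setT Z1 -> measurable_fun setT Z2 ->
  (forall w, 0 <= Z1 w) -> (forall w, 0 <= Z2 w) ->
  (forall B, measurable B ->
     (\int[mu1]_w ((Z1 w)%:E * (\1_B (X1 w))%:E) =
      \int[mu2]_w ((Z2 w)%:E * (\1_B (X2 w))%:E))%E) ->
  measurable_fun setT g -> (forall u, 0 <= g u) ->
  (\int[mu1]_w ((Z1 w)%:E * (g (X1 w))%:E) =
   \int[mu2]_w ((Z2 w)%:E * (g (X2 w))%:E))%E.
Proof.
move=> mX1 mX2 mZ1 mZ2 Z10 Z20 H mg g0.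
rewrite (integral_weight_approx mu1 mX1 mZ1 Z10 mg g0).
rewrite (integral_weight_approx mu2 mX2 mZ2 Z20 mg g0).
congr (limn _); apply/funext => n; apply: eq_fsbigr => k _; congr (_ * _)%E.
exact: H.
Qed.

End WeightedLaws.

(** * Expectation of a product of independent variables *)

Section Independence.
Context {d : measure_display} {T : measurableType d} {R : realType}
  (P : probability T R) {d' : measure_display} {U : measurableType d'}
  {n : nat} (X : 'I_n -> T -> U).
Hypotheses (mX : forall i, measurable_fun setT (X i))
  (indX : mutually_independent P X).

Let integral_comp_indic B i : measurable B ->
  (\int[P]_w (\1_B (X i w))%:E = P (X i @^-1` B))%E.
Proof.
move=> mB; rewrite -[in RHS](setIT (X i @^-1` B)) -integral_indic //.
by rewrite -[X in measurable X]setTI; exact: mX.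
Qed.

(* s lists the factors not yet replaced by indicators; for indicators the claim
   is the definition of mutual independence. *)
Let integral_prod_indep_aux (s : seq 'I_n) (f : 'I_n -> U -> R) :
  (forall i, measurable_fun setT (f i)) -> (forall i u, 0 <= f i u) ->
  (forall i, \int[P]_w (f i (X i w))%:E \is a fin_num)%E ->
  (forall i, i \notin s -> exists B, measurable B /\ f i = \1_B) ->
  (\int[P]_w (\prod_i f i (X i w))%:E = \prod_i \int[P]_w (f i (X i w))%:E)%E.
Proof.
elim: s f => [|j s IH] f mf f0 ff fs.
  have {}fs i := fs i isT.
  have [B HB] := choice fs.
  have XB i : measurable (X i @^-1` B i).
    by rewrite -[X in measurable X]setTI; apply: mX => //; exact: (HB i).1.
  transitivity (P (\bigcap_(i in [set` [set: 'I_n]%SET]) (X i @^-1` B i))).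
    rewrite -[in RHS](setIT (\bigcap_(i in _) _)).
    rewrite -integral_indic //; last first.
      by apply: fin_bigcap_measurable => //; exact: finite_finset.
    apply: eq_integral => w _; congr EFin.
    under eq_bigr do rewrite (HB _).2.
    rewrite indicE; case: (boolP (w \in _)) => [|/negP]; rewrite inE => h.
      by rewrite big1 // => i _; rewrite indicE mem_set //; apply: (h i); rewrite /= inE.
    have [i hi] : exists i, ~ B i (X i w).
      by apply/existsNP => h'; apply: h => i _; exact: h'.
    by rewrite (bigD1 i) //= indicE memNset // mul0r.
  rewrite indX; last by move=> i; exact: (HB i).1.
  under eq_bigl do rewrite inE.
  apply: eq_bigr => i _; rewrite (HB i).2 integral_comp_indic //; exact: (HB i).1.
(* The law of [X j] weighted by [Z] is compared with the one weighted by the constant [kap]. By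
   [integral_weight_law] it suffices to treat an indicator in place of [f j], and then the induction
   hypothesis applies to [f']. *)
pose Z w := \prod_(i | i != j) f i (X i w).
pose kap := \prod_(i | i != j) fine (\int[P]_w (f i (X i w))%:E)%E.
have kapE : (kap%:E = \prod_(i | i != j) \int[P]_w (f i (X i w))%:E)%E.
  by rewrite /kap; elim/big_rec2: _ => // i x y _ <-; rewrite EFinM fineK.
have kap0 : 0 <= kap.
  apply: prodr_ge0 => i _; apply: fine_ge0; apply: integral_ge0 => w _.
  by rewrite lee_fin.
rewrite [RHS](bigD1 j) //= -kapE muleC.
transitivity (\int[P]_w ((Z w)%:E * (f j (X j w))%:E))%E.
  by apply: eq_integral => w _; rewrite (bigD1 j) //= mulrC EFinM.
have mfX i : measurable_fun setT (fun w => f i (X i w)).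
  exact: measurableT_comp (mf i) (mX i).
transitivity (\int[P]_w (kap%:E * (f j (X j w))%:E))%E; last first.
  rewrite ge0_integralZl_EFin //; first by move=> w _; rewrite lee_fin.
  exact/measurable_EFinP.
apply: (@integral_weight_law _ _ _ P _ _ P _ _ (X j) (X j) Z (fun=> kap)) => //.
- rewrite /Z; under eq_fun do rewrite -big_filter.
  exact: measurable_prod.
- by move=> w; apply: prodr_ge0.
move=> B mB.
have mI : measurable_fun setT (\1_B : U -> R) by [].
have mIX : measurable_fun setT (fun w => (\1_B (X j w))%:E : \bar R).
  by apply/measurable_EFinP; exact: measurableT_comp mI (mX j).
rewrite ge0_integralZl_EFin //.
pose f' i := if i == j then \1_B else f i.
have f'j : f' j = \1_B by rewrite /f' eqxx.
have f'N i : i != j -> f' i = f i by move=> /negPf ij; rewrite /f' ij.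
transitivity (\int[P]_w (\prod_i f' i (X i w))%:E)%E.
  apply: eq_integral => w _; rewrite (bigD1 j) //= f'j mulrC -EFinM.
  by congr (EFin (_ * _)); apply: eq_bigr => i ij; rewrite f'N.
rewrite IH; first last.
- move=> i si; have [->|ij] := eqVneq i j; first by exists B.
  by rewrite f'N //; apply: fs; rewrite in_cons negb_or ij.
- move=> i; have [->|ij] := eqVneq i j; last by rewrite f'N.
  rewrite f'j integral_comp_indic //; apply: fin_num_measure.
  by rewrite -[X in measurable X]setTI; exact: mX.
- by move=> i u; have [->|ij] := eqVneq i j; rewrite (f'j, f'N).
- by move=> i; have [->|ij] := eqVneq i j; rewrite (f'j, f'N).
rewrite (bigD1 j) //= f'j muleC kapE; congr (_ * _)%E.
by apply: eq_bigr => i ij; rewrite f'N.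
Qed.

Lemma integral_prod_indep (f : 'I_n -> U -> R) :
  (forall i, measurable_fun setT (f i)) -> (forall i u, 0 <= f i u) ->
  (forall i, \int[P]_w (f i (X i w))%:E \is a fin_num)%E ->
  (\int[P]_w (\prod_i f i (X i w))%:E = \prod_i \int[P]_w (f i (X i w))%:E)%E.
Proof.
move=> mf f0 ff; apply: (@integral_prod_indep_aux (enum 'I_n)) => // i.
by rewrite mem_enum.
Qed.

End Independence.

(** Cauchy-Schwarz, through the Lagrange identity, puts [a x + b y] in the range of
    [expR_le_quadratic]. The linear term is kept because it averages to zero over the phase. *)
Lemma expR_le_linear (R : realType) (a b x y : R) :
  a ^+ 2 + b ^+ 2 <= 1 / 4 -> x ^+ 2 + y ^+ 2 = 1 ->
  expR (a * x + b * y) <= 1 + (a * x + b * y) + 2 * (a ^+ 2 + b ^+ 2).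
Proof.
move=> ab xy.
have cs : (a * x + b * y) ^+ 2 <= a ^+ 2 + b ^+ 2.
  rewrite -[leRHS]mulr1 -xy -subr_ge0.
  have -> : (a ^+ 2 + b ^+ 2) * (x ^+ 2 + y ^+ 2) - (a * x + b * y) ^+ 2 =
    (a * y - b * x) ^+ 2 by ring.
  exact: sqr_ge0.
have h : a * x + b * y <= 1 / 2.
  rewrite leNgt; apply/negP => h; nra.
apply: le_trans (expR_le_quadratic h) _; lra.
Qed.

(** * Rademacher and Steinhaus variables, treated together *)

Section Phase.
Context {d : measure_display} {T : measurableType d} {R : realType}
  (P : probability T R) (X : T -> R[i]).

Definition uniform_phase := uniform_sign P X \/ uniform_circle P X.

Lemma measurable_set1_pair (x y : R) : measurable [set (x, y)].
Proof.
have -> : [set (x, y)] = [set x] `*` [set y].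
  by apply/seteqP; split => [_ -> //|[u v] [/= -> ->]].
exact: measurableX.
Qed.

Lemma uniform_phase_measurable : uniform_phase -> measurable_fun setT (@reim R \o X).
Proof. by case=> [[]|[]]. Qed.

Lemma uniform_sign_measurable (x : R) : uniform_phase -> measurable [set w | X w = x%:C].
Proof.
move=> /uniform_phase_measurable mX.
have -> : [set w | X w = x%:C] = (@reim R \o X) @^-1` [set (x, 0)].
  apply/seteqP; split => w /=; rewrite /reim; first by move=> ->.
  by case: (X w) => u v /= [-> ->].
by rewrite -[X in measurable X]setTI; apply: mX => //; exact: measurable_set1_pair.
Qed.

Let unit_circle : set (R * R) := [set p | p.1 ^+ 2 + p.2 ^+ 2 = 1].

Let measurable_unit_circle : measurable unit_circle.
Proof.
have -> : unit_circle = (fun p : R * R => p.1 ^+ 2 + p.2 ^+ 2) @^-1` [set 1] by [].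
rewrite -[X in measurable X]setTI.
suff : measurable_fun setT (fun p : R * R => p.1 ^+ 2 + p.2 ^+ 2) by apply.
by apply: measurable_funD; apply: measurable_funX.
Qed.

(** Only the law of the phase is prescribed, so it has modulus one merely almost surely; the
    exceptional set becomes a null bad event. *)
Lemma uniform_phase_unit : uniform_phase -> P [set w | normc (X w) ^+ 2 = 1] = 1%E.
Proof.
move=> uX; have mX := uniform_phase_measurable uX.
have E : [set w | normc (X w) ^+ 2 = 1] = (@reim R \o X) @^-1` unit_circle.
  by apply/seteqP; split => w /=; rewrite sqr_normcE.
have mE : measurable [set w | normc (X w) ^+ 2 = 1].
  by rewrite E -[X in measurable X]setTI; exact: mX.
case: (uX) => [[_ P1 PN1]|[_ PX]].
  apply/eqP; rewrite eq_le probability_le1 //=.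
  have mA := uniform_sign_measurable 1 uX; have mB := uniform_sign_measurable (-1) uX.
  have -> : (1 = P ([set w | X w = 1%:C] `|` [set w | X w = (-1)%:C]))%E.
    rewrite measureU //; last first.
      apply/seteqP; split => w //= [-> /eqP]; rewrite eq_complex /= => /andP[/eqP h _].
      by have := ltr01 (R := R); lra.
    have -> : [set w | X w = (-1)%:C] = [set w | X w = -1].
      by rewrite rmorphN1.
    by rewrite [X in (X + _)%E]P1 [X in (_ + X)%E]PN1 -EFinD; congr EFin; lra.
  apply: le_measure; rewrite ?inE //; first exact: measurableU.
  by move=> w /= [|] ->; rewrite normc_real ?normrN normr1 expr1n.
rewrite E PX //.
have -> : [set t : R | (0 <= t < 2 * pi)%R /\ unit_circle (cos t, sin t)] =
    [set` `[0, 2 * pi[%R].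
  apply/seteqP; split => t /=; rewrite in_itv /=; first by case.
  by move=> h; split=> //; rewrite /unit_circle /= cos2Dsin2.
rewrite lebesgue_measure_itv /= lte_fin mulr_gt0 ?pi_gt0 // sube0 -EFinM mulVf //.
by rewrite gt_eqF // mulr_gt0 ?pi_gt0.
Qed.

(** The two atoms already carry total mass one, so the integrand agrees almost everywhere with a
    combination of two indicators. *)
Lemma integral_uniform_sign (g : R * R -> R) : uniform_sign P X ->
  measurable_fun setT g -> (forall u, 0 <= g u) ->
  (\int[P]_w (g (reim (X w)))%:E = ((g (1, 0) + g (-1, 0)) / 2)%:E)%E.
Proof.
move=> uX mg g0; have [mX P1 PN1] := uX; have uX' : uniform_phase by left.
pose A := [set w | X w = 1%:C]; pose B := [set w | X w = (-1)%:C].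
have mA : measurable A := uniform_sign_measurable 1 uX'.
have mB : measurable B := uniform_sign_measurable (-1) uX'.
have PA : (P A = 2^-1%:E)%E by [].
have PB : (P B = 2^-1%:E)%E by rewrite /B rmorphN1.
have AB : A `&` B = set0.
  apply/seteqP; split => w // -[]; rewrite /A /B /= => -> /eqP.
  rewrite eq_complex /= => /andP[/eqP h _].
  by have := ltr01 (R := R); lra.
have PAB : (P (A `|` B) = 1)%E.
  rewrite measureU // [X in (X + _)%E]PA [X in (_ + X)%E]PB -EFinD.
  by congr EFin; lra.
have ABN w : A w -> B w -> False by move=> Aw Bw; rewrite -[False]/(set0 w) -AB.
have mgX : measurable_fun setT (fun w => g (reim (X w))) by exact: measurableT_comp mg mX.
have mI C : measurable C -> measurable_fun setT (EFin \o (\1_C : T -> R)).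
  by move=> mC; apply/measurable_EFinP; exact: measurable_indic.
transitivity (\int[P]_w ((g (1, 0))%:E * (\1_A w)%:E + (g (-1, 0))%:E * (\1_B w)%:E))%E.
  apply: ge0_ae_eq_integral => //.
  - exact/measurable_EFinP.
  - by apply: emeasurable_funD; apply: emeasurable_funM => //; exact: mI.
  - by move=> w _; rewrite lee_fin.
  - by move=> w _; rewrite adde_ge0 // mule_ge0 ?lee_fin.
  exists (~` (A `|` B)); split.
  - by apply: measurableC; exact: measurableU.
  - apply: etrans (probability_setC P (measurableU _ _ mA mB)) _.
    by rewrite PAB subee.
  - move=> w /= nw; apply: contra_not nw => -[] ABw _.
      rewrite /reim ABw /= !indicE mem_set // memNset; last first.
        exact: ABN.
      by rewrite mule1 mule0 adde0.
    have wA : ~ A w by move=> /ABN; exact.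
    by rewrite /reim ABw /= !indicE (memNset wA) mem_set // mule1 mule0 add0e.
rewrite ge0_integralD //.
- transitivity ((g (1, 0))%:E * P A + (g (-1, 0))%:E * P B)%E.
    by rewrite !ge0_integralZl_EFin ?integral_indic ?setIT //; exact: mI.
  by rewrite PA PB -!EFinM -EFinD mulrDl.
- by move=> w _; rewrite mule_ge0 ?lee_fin.
- by apply: emeasurable_funM => //; exact: mI.
- by move=> w _; rewrite mule_ge0 ?lee_fin.
- by apply: emeasurable_funM => //; exact: mI.
Qed.
End Phase.

Section PhaseMgf.
Context {d : measure_display} {T : measurableType d} {R : realType}
  (P : probability T R) (X : T -> R[i]).
Local Notation mu := (@lebesgue_measure R).

Let circle (t : R) : R * R := (cos t, sin t).

Let measurable_circle : measurable_fun setT circle.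
Proof.
by apply: measurable_fun_pair; apply: continuous_measurable_fun;
  [exact: continuous_cos|exact: continuous_sin].
Qed.

Lemma integral_uniform_circle (g : R * R -> R) : uniform_circle P X ->
  measurable_fun setT g -> (forall u, 0 <= g u) ->
  (\int[P]_w (g (reim (X w)))%:E =
   (2 * pi)^-1%:E * \int[mu]_(t in `[0%R, (2 * pi)%R[) (g (cos t, sin t))%:E)%E.
Proof.
move=> [mX PX] mg g0.
have pi2 : 0 <= (2 * pi)^-1 :> R by rewrite invr_ge0 mulr_ge0 // pi_ge0.
pose I : set R := `[0%R, (2 * pi)%R[%classic.
have mI : measurable I by exact: measurable_itv.
pose Z (t : R) : R := (2 * pi)^-1 * \1_I t.
have mZ : measurable_fun setT Z.
  by apply: measurable_funM => //; exact: measurable_indic.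
have Z0 t : 0 <= Z t by rewrite /Z mulr_ge0 // indicE.
have restr (h : R * R -> R) : measurable_fun setT h -> (forall u, 0 <= h u) ->
    (\int[mu]_t ((Z t)%:E * (h (circle t))%:E) =
     (2 * pi)^-1%:E * \int[mu]_(t in I) (h (circle t))%:E)%E.
  move=> mh h0; rewrite [in RHS]integral_mkcond -ge0_integralZl_EFin //.
  - apply: eq_integral => t _; rewrite /Z patchE indicE; case: ifPn => _.
      by rewrite mulr1.
    by rewrite mulr0 mul0e mule0.
  - by move=> t _; apply: erestrict_ge0 => u _; rewrite lee_fin.
  - apply/(measurable_restrictT _ mI); apply: measurable_funTS.
    by apply/measurable_EFinP; exact: measurableT_comp mh measurable_circle.
rewrite -restr //.
transitivity (\int[P]_w (1%:E * (g (reim (X w)))%:E))%E.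
  by apply: eq_integral => w _; rewrite mul1e.
apply: (@integral_weight_law _ _ _ P _ _ mu _ _ (@reim R \o X) circle (fun=> 1) Z) => //.
move=> B mB; rewrite restr //.
have mXB : measurable ((@reim R \o X) @^-1` B).
  by rewrite -[X in measurable X]setTI; exact: mX.
transitivity (P ((@reim R \o X) @^-1` B)).
  rewrite -[in RHS](setIT (_ @^-1` _)) -integral_indic //.
  by apply: eq_integral => w _; rewrite mul1e.
rewrite PX //; congr (_ * _)%E.
have mcB : measurable (circle @^-1` B).
  by rewrite -[X in measurable X]setTI; exact: measurable_circle.
transitivity (\int[mu]_(t in I) (\1_(circle @^-1` B) t)%:E)%E; last by [].
rewrite integral_indic //; congr (mu _); apply/seteqP.
by split => t /=; rewrite /I /= in_itv /= => -[].
Qed.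

(** Over a full period the trigonometric terms integrate to zero; this is the vanishing mean of a
    Steinhaus variable. *)
Lemma integral_trig_affine (p k a b : R) : 0 < p -> sin p = 0 -> cos p = 1 ->
  (\int[mu]_(t in `[0%R, p]) (k + (a * cos t + b * sin t))%:E = (k * p)%:E)%E.
Proof.
move=> p0 sp cp; pose F (t : R) : R := k * t + (a * sin t - b * cos t).
have dF (t : R) : is_derive t 1 F (k + (a * cos t + b * sin t)).
  rewrite /F; apply: is_derive_eq.
  by rewrite /GRing.scale /=; ring.
have cF t : {for t, continuous F}.
  apply: differentiable_continuous; apply/derivable1_diffP.
  exact: (@ex_derive _ _ _ _ _ _ _ (dF t)).
rewrite (@continuous_FTC2 _ _ F).
- by rewrite /F sp cp mulr0 sin0 cos0 -EFinD; congr EFin; ring.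
- exact: p0.
- apply: continuous_subspaceT => t.
  apply: cvgD; first exact: cvg_cst.
  apply: cvgD; apply: cvgM; try exact: cvg_cst.
    exact: continuous_cos.
  exact: continuous_sin.
- split.
  + by move=> t _; exact: (@ex_derive _ _ _ _ _ _ _ (dF t)).
  + by apply: cvg_at_right_filter; exact: cF.
  + by apply: cvg_at_left_filter; exact: cF.
- by move=> t _; rewrite derive1E; exact: derive_val.
Qed.

(** Average [expR_le_linear]: its linear term cancels between the two signs, or over a period of the
    circle. *)
Lemma uniform_phase_mgf (a b : R) : uniform_phase P X -> a ^+ 2 + b ^+ 2 <= 1 / 4 ->
  (\int[P]_w (expR (a * complex.Re (X w) + b * complex.Im (X w)))%:E <=
   (1 + 2 * (a ^+ 2 + b ^+ 2))%:E)%E.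
Proof.
move=> uX ab; pose g (p : R * R) := expR (a * p.1 + b * p.2).
have mg : measurable_fun setT g.
  apply: measurableT_comp; first exact: measurable_expR.
  by apply: measurable_funD; apply: measurable_funM.
have g0 u : 0 <= g u by exact: expR_ge0.
case: uX => uX.
  rewrite [leLHS](integral_uniform_sign uX mg g0) lee_fin.
  have h1 : g (1, 0) <= _ := expR_le_linear ab (_ : 1 ^+ 2 + 0 ^+ 2 = 1).
  have h2 : g (-1, 0) <= _ := expR_le_linear ab (_ : (-1) ^+ 2 + 0 ^+ 2 = 1).
  have {}h1 := h1 ltac:(ring); have {}h2 := h2 ltac:(ring); lra.
rewrite [leLHS](integral_uniform_circle uX mg g0).
have pi0 : 0 < 2 * pi :> R by rewrite mulr_gt0 // pi_gt0.
set k := 1 + 2 * _.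
have kE : k%:E = ((2 * pi)^-1%:E * \int[mu]_(t in `[0%R, (2 * pi)%R])
    (k + (a * cos t + b * sin t))%:E)%E.
  have s2 : sin (2 * pi) = 0 :> R by rewrite mulr_natl sin2pi.
  have c2 : cos (2 * pi) = 1 :> R by rewrite mulr_natl cos2pi.
  rewrite (integral_trig_affine k a b pi0 s2 c2) -EFinM; congr EFin.
  by rewrite mulrCA mulVf ?mulr1 // gt_eqF.
rewrite [leRHS]kE; apply: lee_wpmul2l; first by rewrite lee_fin invr_ge0 ltW.
have mgc : measurable_fun setT (fun t : R => (g (cos t, sin t))%:E).
  by apply/measurable_EFinP; exact: measurableT_comp mg measurable_circle.
have gk t : g (cos t, sin t) <= k + (a * cos t + b * sin t).
  by have := expR_le_linear ab (cos2Dsin2 t); rewrite /g /k /=; lra.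
(* The half-open interval of the law is enlarged to the closed one of [integral_trig_affine], as the
   integrand is nonnegative. *)
apply: (@le_trans _ _ (\int[mu]_(t in `[0%R, (2 * pi)%R]) (g (cos t, sin t))%:E)%E).
  apply: ge0_subset_integral => //.
  - exact: measurable_funTS.
  - by move=> t _; rewrite lee_fin.
  - by move=> t /=; rewrite !in_itv /= => /andP[-> /ltW].
have mk : measurable_fun setT (fun t : R => (k + (a * cos t + b * sin t))%:E).
  apply/measurable_EFinP; apply: measurable_funD => //.
  apply: measurable_funD; apply: measurable_funM => //;
  apply: continuous_measurable_fun; [exact: continuous_cos|exact: continuous_sin].
by apply: ge0_le_integral => //;
  do ?[exact: measurable_funTS | by move=> t _; rewrite lee_fin].
Qed.

End PhaseMgf.

Section PhaseSums.
Context {d : measure_display} {T : measurableType d} {R : realType}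
  (P : probability T R) {N : nat} (c : 'I_N -> T -> R[i]).
Hypothesis N0 : (0 < N)%N.
Hypotheses (uc : forall k, uniform_phase P (c k))
  (ic : mutually_independent P (fun k => @reim R \o c k)).
Local Notation Re := complex.Re.
Local Notation Im := complex.Im.

Lemma measurable_Re k : measurable_fun setT (fun w => Re (c k w)).
Proof. exact: (measurableT_comp measurable_fst (uniform_phase_measurable (uc k))). Qed.

Lemma measurable_Im k : measurable_fun setT (fun w => Im (c k w)).
Proof. exact: (measurableT_comp measurable_snd (uniform_phase_measurable (uc k))). Qed.

Lemma phase_sum_mgf (a b : 'I_N -> R) :
  (forall k, a k ^+ 2 + b k ^+ 2 <= 1 / 4) ->
  (\int[P]_w (expR (\sum_k (a k * Re (c k w) + b k * Im (c k w))))%:E <=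
   (expR (2 * \sum_k (a k ^+ 2 + b k ^+ 2)))%:E)%E.
Proof.
move=> ab.
pose f k (p : R * R) := expR (a k * p.1 + b k * p.2).
have mf k : measurable_fun setT (f k).
  apply: measurableT_comp; first exact: measurable_expR.
  by apply: measurable_funD; apply: measurable_funM.
have f0 k u : 0 <= f k u by exact: expR_ge0.
have fle k := uniform_phase_mgf (uc k) (ab k).
have int0 k : (0 <= \int[P]_w (f k (reim (c k w)))%:E)%E.
  by apply: integral_ge0 => w _; rewrite lee_fin.
have -> : (\int[P]_w (expR (\sum_k (a k * Re (c k w) + b k * Im (c k w))))%:E =
    \int[P]_w (\prod_k f k (reim (c k w)))%:E)%E.
  by apply: eq_integral => w _; rewrite expR_sum.
rewrite (integral_prod_indep (fun k => uniform_phase_measurable (uc k)) ic mf f0); last first.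
  by move=> k; rewrite ge0_fin_numE //; apply: le_lt_trans (fle k) _; rewrite ltry.
apply: (@le_trans _ _ (\prod_k (1 + 2 * (a k ^+ 2 + b k ^+ 2)))%:E)%E.
  have H : (0 <= \prod_k \int[P]_w (f k (reim (c k w)))%:E <= 
      (\prod_k (1 + 2 * (a k ^+ 2 + b k ^+ 2)))%:E)%E.
    elim/big_rec2: _ => [|k x y _ /andP[x0 xy]]; first by rewrite lexx lee_fin ler01.
    rewrite mule_ge0 //= EFinM; apply: lee_pmul => //; exact: fle.
  by case/andP: H.
rewrite lee_fin mulr_sumr expR_sum; apply: ler_prod => k _.
by rewrite expR_ge1Dx addr_ge0 // mulr_ge0 // addr_ge0 // sqr_ge0.
Qed.

(** Exponential Markov inequality with [phase_sum_mgf]. The exponent is linear in [t], since that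
    bound holds only for small coefficients; this costs a logarithm in the coherence. *)
Lemma phase_sum_tail (a b : 'I_N -> R) (t : R) :
  \sum_k (a k ^+ 2 + b k ^+ 2) <= N%:R^-1 ->
  (P [set w | (t < \sum_k (a k * Re (c k w) + b k * Im (c k w)))%R] <=
   (expR (1 / 2 - Num.sqrt N%:R * t / 2))%:E)%E.
Proof.
(* The largest [lam] that the weight bound [1 / N] guarantees to be admissible: [lam^2 / N = 1/4].
   The quadratic term is then at most [2 lam^2 / N = 1/2]. *)
move=> ab; have [lam lamE] : exists lam : R, lam = Num.sqrt N%:R / 2 by eexists.
have NR : 0 < N%:R :> R by rewrite ltr0n.
have lam2 : lam ^+ 2 = N%:R / 4.
  by rewrite lamE expr_div_n sqr_sqrtr ?ler0n //; congr (_ / _); ring.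
have lam0 : 0 <= lam by rewrite lamE divr_ge0 // sqrtr_ge0.
have abk k : (lam * a k) ^+ 2 + (lam * b k) ^+ 2 <= 1 / 4.
  rewrite !exprMn -mulrDr lam2.
  have h : a k ^+ 2 + b k ^+ 2 <= N%:R^-1.
    apply: le_trans ab; rewrite [leRHS](bigD1 k) //= lerDl sumr_ge0 // => i _.
    by rewrite addr_ge0 ?sqr_ge0.
  apply: le_trans (ler_wpM2l _ h) _; first by rewrite divr_ge0.
  by rewrite mulrAC mulfV // gt_eqF.
have mS : measurable_fun setT (fun w => \sum_k (a k * Re (c k w) + b k * Im (c k w))).
  apply: measurable_sum => k; apply: measurable_funD; apply: measurable_funM => //.
    exact: measurable_Re.
  exact: measurable_Im.
pose E := [set w | t < \sum_k (a k * Re (c k w) + b k * Im (c k w))].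
have mE : measurable E.
  rewrite (_ : E = (fun w => \sum_k (a k * Re (c k w) + b k * Im (c k w))) @^-1` `]t, +oo[).
    by rewrite -[X in measurable X]setTI; apply: mS.
  by apply/seteqP; split => w; rewrite /= in_itv /= andbT.
have mZ : measurable_fun setT (fun w =>
    (expR (\sum_k (lam * a k * Re (c k w) + lam * b k * Im (c k w))))%:E).
  apply/measurable_EFinP; apply: measurableT_comp; first exact: measurable_expR.
  apply: measurable_sum => k; apply: measurable_funD; apply: measurable_funM => //.
    exact: measurable_Re.
  exact: measurable_Im.
rewrite -/E -(setIT E) -integral_indic //.
apply: (@le_trans _ _ (\int[P]_w ((expR (- (lam * t)))%:E *
    (expR (\sum_k (lam * a k * Re (c k w) + lam * b k * Im (c k w))))%:E))%E).
  apply: ge0_le_integral => //.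
  - by apply/measurable_EFinP; exact: measurable_indic.
  - by apply: emeasurable_funM.
  - move=> w _; rewrite -EFinM lee_fin -expRD indicE.
    case: (boolP (w \in E)) => [|_]; last exact: expR_ge0.
    rewrite inE /E /= => h; rewrite -expR0 ler_expR.
    have -> : \sum_k (lam * a k * Re (c k w) + lam * b k * Im (c k w)) =
        lam * \sum_k (a k * Re (c k w) + b k * Im (c k w)).
      by rewrite mulr_sumr; apply: eq_bigr => k _; ring.
    by rewrite addrC -mulrBr mulr_ge0 // subr_ge0 ltW.
rewrite ge0_integralZl_EFin ?expR_ge0 //.
apply: le_trans (lee_wpmul2l _ (phase_sum_mgf abk)) _; first by rewrite lee_fin expR_ge0.
rewrite -EFinM lee_fin -expRD ler_expR addrC.
have -> : Num.sqrt N%:R * t / 2 = lam * t by rewrite lamE; ring.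
rewrite lerD2r; under eq_bigr do rewrite !exprMn -mulrDr.
rewrite -mulr_sumr lam2.
apply: le_trans (ler_wpM2l _ (ler_wpM2l _ ab)) _ => //.
rewrite mulrAC mulfV ?gt_eqF //; lra.
Qed.

End PhaseSums.

(** * Coherence of the randomized sensing matrix *)

Section SensingMatrix.
Local Open Scope sesquilinear_scope.
Context {R : realType} {N : nat}.
Variables (Phi Psi : 'M[R[i]]_N).
Hypotheses (uPhi : Phi \is unitarymx) (uPsi : Psi \is unitarymx).

Lemma Ac_entry (c : 'I_N -> R[i]) j k :
  Ac Phi Psi c j k = \sum_i (Phi i j)^*%C * Psi i k * c i.
Proof.
rewrite /Ac !mxE; apply: eq_bigr => i _.
by rewrite mul_mx_diag !mxE mulrAC.
Qed.

Lemma unitarymx_col (A : 'M[R[i]]_N) k i : A \is unitarymx ->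
  \sum_j (A j k)^*%C * A j i = (k == i)%:R.
Proof.
move=> /unitarymxP /mulmx1C /matrixP /(_ k i); rewrite !mxE => <-.
by apply: eq_bigr => j _; rewrite !mxE.
Qed.

Lemma unitarymx_row (A : 'M[R[i]]_N) k : A \is unitarymx ->
  \sum_j normc (A k j) ^+ 2 = 1.
Proof.
move=> /unitarymxP /matrixP /(_ k k); rewrite !mxE eqxx => h.
apply: complexI; rewrite -[RHS]h rmorph_sum /=.
by apply: eq_bigr => j _; rewrite -mulcJ mulrC !mxE.
Qed.

Lemma Ac_orthonormal (c : 'I_N -> R[i]) k i : (forall l, normc (c l) ^+ 2 = 1) ->
  \sum_j (Ac Phi Psi c j k)^*%C * Ac Phi Psi c j i = (k == i)%:R.
Proof.
move=> c1; apply: unitarymx_col; rewrite /Ac; apply: mul_unitarymx; last exact: uPsi.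
apply: mul_unitarymx; first by rewrite trmxC_unitary.
apply/unitarymxP; rewrite tr_diag_mx map_diag_mx mulmx_diag.
apply/matrixP => a b; rewrite [LHS]mxE [RHS]mxE; congr (_ *+ _).
by rewrite !mxE mulrC [LHS]mulcJ c1.
Qed.

Hypothesis flatPhi : forall k i k' i' : 'I_N, `|Phi k i| = `|Phi k' i'|.

(** Flatness and unit rows force every squared entry of [Phi] to equal [1 / N]; the unit column of
    [Psi] sums the rest to 1. *)
Lemma sensing_weight j k : \sum_i normc ((Phi i j)^*%C * Psi i k) ^+ 2 = N%:R^-1.
Proof.
have NR : N%:R != 0 :> R.
  by rewrite pnatr_eq0 -lt0n (leq_ltn_trans (leq0n j)).
have flat i : normc (Phi i j) ^+ 2 = N%:R^-1.
  have h := unitarymx_row i uPhi.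
  have e l : normc (Phi i l) ^+ 2 = normc (Phi i j) ^+ 2.
    by rewrite -!Re_norm (flatPhi i l i j).
  rewrite (eq_bigr _ (fun l _ => e l)) sumr_const card_ord -mulr_natl in h.
  by apply: (mulfI NR); rewrite h mulfV.
under eq_bigr do rewrite normcM normcJ exprMn flat.
rewrite -mulr_sumr -[RHS]mulr1; congr (_ * _).
apply: complexI; rewrite rmorph_sum /=.
under eq_bigr do rewrite -mulcJ.
by rewrite unitarymx_col // eqxx.
Qed.

End SensingMatrix.

Section Coherence.
Context {d : measure_display} {T : measurableType d} {R : realType}
  (P : probability T R) {N : nat} (c : 'I_N -> T -> R[i]).
Hypothesis N0 : (0 < N)%N.
Hypotheses (uc : forall k, uniform_phase P (c k))
  (ic : mutually_independent P (fun k => @reim R \o c k)).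
Variables (Phi Psi : 'M[R[i]]_N).
Hypotheses (uPhi : universal_sensing_basis Phi) (uPsi : Psi \is unitarymx).

Lemma directionM (p : bool * bool) (z w : R[i]) :
  direction p (z * w) =
    (-1) ^+ p.1 * (if p.2 then complex.Re z else complex.Im z) * complex.Re w +
    (-1) ^+ p.1 * (if p.2 then - complex.Im z else complex.Re z) * complex.Im w.
Proof. by rewrite /direction; case: p.2; rewrite ?ReM ?ImM; ring. Qed.

Lemma Ac_direction_tail p j k (t : R) :
  (P [set w | t < direction p (Ac Phi Psi (c ^~ w) j k)]%R <=
   (expR (1 / 2 - Num.sqrt N%:R * t / 2))%:E)%E.
Proof.
pose A i := (Phi i j)^*%C * Psi i k.
pose a i := (-1) ^+ p.1 * (if p.2 then complex.Re (A i) else complex.Im (A i)).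
pose b i := (-1) ^+ p.1 * (if p.2 then - complex.Im (A i) else complex.Re (A i)).
have -> : [set w | t < direction p (Ac Phi Psi (c ^~ w) j k)]%R =
  [set w | t < \sum_i (a i * complex.Re (c i w) + b i * complex.Im (c i w))].
  apply/funext => w; rewrite /mkset Ac_entry direction_sum; congr (is_true (_ < _)).
  by apply: eq_bigr => i _; exact: directionM.
apply: phase_sum_tail => //.
rewrite -(sensing_weight uPhi.1 uPsi uPhi.2 j k) ler_sum // => i _.
(* In every direction, [a i] and [b i] are the real and imaginary parts of [A i] up to order and
   sign. *)
rewrite /a /b !exprMn !sqrr_sign !mul1r sqr_normcE -/(A i).
by case: p.2; rewrite ?sqrrN // addrC.
Qed.

End Coherence.

(** * Assembling the events *)

Section ProbabilityBounds.
Context {d : measure_display} {T : measurableType d} {R : realType}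
  (P : probability T R).

Lemma probability_union_bound (I : eqType) (r : seq I) (F : I -> set T) (E : set T) :
  measurable E -> (forall i, measurable (F i)) ->
  (forall w, E w -> exists2 i, i \in r & F i w) ->
  (P E <= \sum_(i <- r) P (F i))%E.
Proof.
move=> mE mF; elim: r E mE => [|i r IH] E mE EF.
  rewrite big_nil (_ : E = set0) ?measure0 //.
  by apply/seteqP; split => // w /EF [].
rewrite big_cons.
have mEF : measurable (E `\` F i) by exact: measurableD.
apply: (@le_trans _ _ (P (F i) + P (E `\` F i))%E).
  apply: (@le_trans _ _ (P (F i `|` (E `\` F i)))).
    apply: le_measure; rewrite ?inE //; first exact: measurableU.
    by move=> w Ew; have [|] := pselect (F i w); [left|right].
  apply: measureU2 => //.
apply: leeD => //; apply: IH => // w [/EF [j]].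
by rewrite in_cons => /predU1P[->|jr] Fj //; exists j.
Qed.

Variables (N m : nat) (n : nat) (X : 'I_n -> T -> R * R) (l : 'I_m -> T -> 'I_N).
Hypothesis ul : uniform_indices P l.
Hypothesis mX : forall i, measurable_fun setT (X i).
Hypothesis indep : independent_systems P (g_sigma_preimage X)
  (g_sigma_preimage (fun r => index_val (l r))).

Lemma g_sigma_preimage_sub d' (U : measurableType d') k (Y : 'I_k -> T -> U) :
  (forall i, measurable_fun setT (Y i)) -> g_sigma_preimage Y `<=` measurable.
Proof.
move=> mY; apply: smallest_sub; first exact: sigma_algebra_measurable.
elim/big_ind: _ => // [A B sA sB|i _]; first by rewrite subUset.
by move=> _ [B mB <-]; apply: mY.
Qed.

Lemma g_sigma_preimage_gen d' (U : measurableType d') k (Y : 'I_k -> T -> U) i B :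
  measurable B -> g_sigma_preimage Y (Y i @^-1` B).
Proof.
move=> mB; apply: sub_sigma_algebra.
rewrite (bigD1 i) //=; left; exists B => //; by rewrite setTI.
Qed.

Let sample w : m.-tuple 'I_N := [tuple l r w | r < m].

Let sample_preimage (t : m.-tuple 'I_N) :
  [set w | sample w = t] =
  \bigcap_(r in [set` [set: 'I_m]%SET]) (index_val (l r) @^-1` [set nat_of_ord (tnth t r)]).
Proof.
apply/seteqP; split => w /=.
  by move=> <- r _; rewrite /index_val /= tnth_mktuple.
move=> h; apply: eq_from_tnth => r; rewrite tnth_mktuple.
apply: val_inj; apply: (h r); by rewrite /= inE.
Qed.

Let sample_sigma t : g_sigma_preimage (fun r => index_val (l r)) [set w | sample w = t].
Proof.
rewrite sample_preimage.
pose G : set (set T) :=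
  \big[setU/set0]_(r < m) preimage_set_system setT (index_val (l r)) measurable.
(* Membership in the generated sigma-algebra is read as measurability in [T] re-equipped with it, so
   that closure under finite intersections applies. *)
change (measurable (\bigcap_(r in [set` [set: 'I_m]%SET])
  (index_val (l r) @^-1` [set nat_of_ord (tnth t r)]) : set (g_sigma_algebraType G))).
apply: fin_bigcap_measurable => [|r _]; first exact: finite_finset.
exact: (g_sigma_preimage_gen (Y := fun r => index_val (l r))).
Qed.

Let sample_prob t : P [set w | sample w = t] = (N%:R ^- m)%:E.
Proof.
have [ml Pl indl] := ul.
rewrite sample_preimage indl //.
rewrite (eq_bigr (fun=> (N%:R^-1)%:E)) => [|r _]; last first.
  rewrite -(Pl r (tnth t r)); congr (P _); apply/seteqP; split => w /=.
    by move=> /val_inj.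
  by rewrite /index_val => ->.
under eq_bigl do rewrite inE.
rewrite (_ : \prod_(r < m) _ = (\prod_(r < m) N%:R^-1)%:E)%E.
  by rewrite prodr_const card_ord exprVn.
by elim/big_rec2: _ => // r x y _ ->; rewrite EFinM.
Qed.

(* H t is the event that the signs are bad for the sample t; being in the
   sigma-algebra of the signs, it is independent of the event that t is drawn. *)
Lemma sampling_bound (H : m.-tuple 'I_N -> set T) (delta : R) :
  (forall t, g_sigma_preimage X (H t)) ->
  (forall w, N%:R ^- m * \sum_t \1_(H t) w <= delta) ->
  measurable [set w | H (sample w) w] /\ (P [set w | H (sample w) w] <= delta%:E)%E.
Proof.
move=> sH Hd.
have mH t : measurable (H t) by exact: (g_sigma_preimage_sub mX).
have mS t : measurable [set w | sample w = t].
  by apply: (g_sigma_preimage_sub (Y := fun r => index_val (l r))) => //; case: ul.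
have E : [set w | H (sample w) w] =
    \bigcup_(t in [set` [set: m.-tuple 'I_N]%SET]) (H t `&` [set w | sample w = t]).
  apply/seteqP; split => w /=; first by move=> h; exists (sample w) => //=; rewrite inE.
  by move=> [t _ [Ht /= st]]; rewrite st.
have mE : measurable [set w | H (sample w) w].
  rewrite E; apply: fin_bigcup_measurable => [|t _]; first exact: finite_finset.
  exact: measurableI.
split => //.
apply: (@le_trans _ _ (\sum_(t : m.-tuple 'I_N) P (H t `&` [set w | sample w = t]))%E).
  apply: probability_union_bound => // [t|w Hw]; first exact: measurableI.
  by exists (sample w); rewrite ?mem_index_enum.
(* Independence turns each term into [N ^- m] times the probability of [H t]; the sum is then the
   expectation of the mean over samples, which is at most [delta] pointwise. *)
under eq_bigr do rewrite indep // sample_prob.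
rewrite (_ : (\sum_t _ = \int[P]_w
    (\sum_(t : m.-tuple 'I_N) (N%:R ^- m)%:E * (\1_(H t) w)%:E))%E); last first.
  rewrite ge0_integral_sum //.
  - apply: eq_bigr => t _; rewrite ge0_integralZl_EFin //.
    + by rewrite integral_indic // setIT muleC.
    + by apply/measurable_EFinP; exact: measurable_indic.
  - move=> t; apply: emeasurable_funM => //.
    by apply/measurable_EFinP; exact: measurable_indic.
have sumE w : (\sum_(t : m.-tuple 'I_N) (N%:R ^- m)%:E * (\1_(H t) w)%:E =
    (N%:R ^- m * \sum_t \1_(H t) w)%:E)%E.
  by rewrite mulr_sumr -sumEFin.
under eq_integral do rewrite sumE.
apply: (@le_trans _ _ (\int[P]_w (cst delta%:E w))%E); last first.
  by rewrite integral_cst // [X in (_ * X)%E](probability_setT P) mule1.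
apply: ge0_le_integral => //.
- move=> w _; rewrite lee_fin; apply: mulr_ge0; first by rewrite invr_ge0 exprn_ge0.
  by apply: sumr_ge0 => t _; rewrite /indic ler0n.
- apply/measurable_EFinP; apply: measurable_funM => //; apply: measurable_sum => t.
  exact: measurable_indic.
- by move=> w _; rewrite lee_fin.
Qed.

End ProbabilityBounds.

(** * Measurability of the golfing events *)

Section Measurability.
Context {d : measure_display} {T : measurableType d} {R : realType}.
Implicit Types f g : T -> R[i].

Definition cmeasurable f :=
  measurable_fun setT (fun w => complex.Re (f w)) /\
  measurable_fun setT (fun w => complex.Im (f w)).

Lemma cmeasurable_cst (z : R[i]) : cmeasurable (fun=> z).
Proof. by split; exact: measurable_cst. Qed.

Lemma cmeasurableD f g : cmeasurable f -> cmeasurable g ->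
  cmeasurable (fun w => f w + g w).
Proof.
move=> [f1 f2] [g1 g2]; split.
  by under eq_fun do rewrite ReD; exact: measurable_funD.
by under eq_fun do rewrite ImD; exact: measurable_funD.
Qed.

Lemma cmeasurableM f g : cmeasurable f -> cmeasurable g ->
  cmeasurable (fun w => f w * g w).
Proof.
move=> [f1 f2] [g1 g2]; split.
  under eq_fun do rewrite ReM.
  by apply: measurable_funB; exact: measurable_funM.
under eq_fun do rewrite ImM.
by apply: measurable_funD; exact: measurable_funM.
Qed.

Lemma cmeasurableN f : cmeasurable f -> cmeasurable (fun w => - f w).
Proof.
move=> mf; under eq_fun do rewrite -mulN1r.
by apply: cmeasurableM => //; exact: cmeasurable_cst.
Qed.

Lemma cmeasurableJ f : cmeasurable f -> cmeasurable (fun w => (f w)^*%C).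
Proof.
move=> [f1 f2]; split.
  by under eq_fun do rewrite ReJ.
by under eq_fun do rewrite ImJ; exact: measurable_funN.
Qed.

Lemma cmeasurable_sum (I : Type) (r : seq I) (F : I -> T -> R[i]) :
  (forall i, cmeasurable (F i)) -> cmeasurable (fun w => \sum_(i <- r) F i w).
Proof.
move=> mF; elim: r => [|i r IH].
  by under eq_fun do rewrite big_nil; exact: cmeasurable_cst.
by under eq_fun do rewrite big_cons; exact: cmeasurableD.
Qed.

Lemma measurable_true : measurable [set w : T | true].
Proof. by rewrite (_ : [set _ | _] = setT); [exact: measurableT|apply/seteqP]. Qed.

Lemma measurable_forall (I : finType) (A : I -> T -> bool) :
  (forall i, measurable [set w | A i w]) -> measurable [set w | [forall i, A i w]].
Proof.
move=> mA; rewrite (_ : [set w | _] = \bigcap_(i in [set` [set: I]%SET]) [set w | A i w]).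
  by apply: fin_bigcap_measurable => [|i _]; [exact: finite_finset|exact: mA].
apply/seteqP; split => w /= => [/forallP h i _|h]; first exact: h.
by apply/forallP => i; apply: (h i); rewrite /= inE.
Qed.

Lemma measurable_andb (A B : T -> bool) :
  measurable [set w | A w] -> measurable [set w | B w] ->
  measurable [set w | A w && B w].
Proof.
move=> mA mB; rewrite (_ : [set w | _] = [set w | A w] `&` [set w | B w]).
  exact: measurableI.
by apply/seteqP; split => w /= /andP.
Qed.

Lemma measurable_norm_le (h : T -> R) b : measurable_fun setT h ->
  measurable [set w | `|h w| <= b].
Proof.
move=> mh; rewrite (_ : [set w | _] = h @^-1` `[- b, b]).
  by rewrite -[X in measurable X]setTI; exact: mh.
by apply/seteqP; split => w; rewrite /= in_itv /= ler_norml.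
Qed.

Lemma measurable_small f b : cmeasurable f -> measurable [set w | small b (f w)].
Proof. by move=> [f1 f2]; apply: measurable_andb; exact: measurable_norm_le. Qed.

Lemma measurable_direction f p (t : R) : cmeasurable f ->
  measurable [set w | t < direction p (f w)].
Proof.
move=> [f1 f2].
rewrite (_ : [set w | _] = (fun w => direction p (f w)) @^-1` `]t, +oo[).
  rewrite -[X in measurable X]setTI.
  suff : measurable_fun setT (fun w => direction p (f w)) by apply.
  by rewrite /direction; case: p.2; apply: measurable_funM.
by apply/seteqP; split => w; rewrite /= in_itv /= andbT.
Qed.

Lemma measurable_unit_norm f : cmeasurable f ->
  measurable [set w | normc (f w) ^+ 2 == 1].
Proof.
move=> [f1 f2].
rewrite (_ : [set w | _] =
  (fun w => complex.Re (f w) ^+ 2 + complex.Im (f w) ^+ 2) @^-1` [set 1]).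
  rewrite -[X in measurable X]setTI.
  suff : measurable_fun setT (fun w => complex.Re (f w) ^+ 2 + complex.Im (f w) ^+ 2).
    by apply.
  by apply: measurable_funD; exact: measurable_funX.
by apply/seteqP; split => w /=; rewrite sqr_normcE => /eqP.
Qed.

Lemma cmeasurable_reim f : measurable_fun setT (@reim R \o f) -> cmeasurable f.
Proof.
by move=> mf; split; [exact: (measurableT_comp measurable_fst mf)
                     |exact: (measurableT_comp measurable_snd mf)].
Qed.

Section Golfing.
Variables (N n : nat) (S : {set 'I_N}) (U : T -> 'I_N -> 'I_N -> R[i]).
Hypothesis mU : forall j k, cmeasurable (fun w => U w j k).

Lemma measurable_frame s q k : (forall i, cmeasurable (fun w => q w i)) ->
  cmeasurable (fun w => frame (U w) n s (q w) k).
Proof.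
move=> mq; apply: cmeasurableM; first exact: cmeasurable_cst.
apply: cmeasurable_sum => j; apply: cmeasurableM; first exact: cmeasurableJ.
by apply: cmeasurable_sum => i; exact: cmeasurableM.
Qed.

(** The vector [q] may depend on [w], because after one step the residual does so through [U w]. *)
Lemma measurable_golf_ok L b s q : (forall i, cmeasurable (fun w => q w i)) ->
  measurable [set w | golf_ok (U w) S n L b (q w) s].
Proof.
elim: L b s q => [|L IH] b s q mq /=; first exact: measurable_true.
apply: measurable_andb.
  apply: measurable_forall => k; apply: measurable_small.
  by apply: cmeasurableD; [exact: measurable_frame|exact: cmeasurableN].
apply: (IH _ _ (fun w => golf_step (U w) S n (q w) (take n s))) => k.
rewrite /golf_step; case: (k \in S); last exact: cmeasurable_cst.
by apply: cmeasurableD; [exact: mq|apply: cmeasurableN; exact: measurable_frame].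
Qed.

Lemma measurable_golf_success L a s :
  measurable [set w | golf_success (U w) S n L a s].
Proof.
apply: measurable_andb.
  by apply: measurable_golf_ok => i; exact: cmeasurable_cst.
apply: measurable_forall => k; case: (k \in S) => /=; last exact: measurable_true.
by apply: measurable_golf_ok => i; exact: cmeasurable_cst.
Qed.

End Golfing.

Lemma measurable_Ac N (c : 'I_N -> T -> R[i]) (Phi Psi : 'M[R[i]]_N) j k :
  (forall i, measurable_fun setT (@reim R \o c i)) ->
  cmeasurable (fun w => Ac Phi Psi (c ^~ w) j k).
Proof.
move=> mc; under eq_fun do rewrite Ac_entry.
apply: cmeasurable_sum => i; apply: cmeasurableM; first exact: cmeasurable_cst.
exact: cmeasurable_reim.
Qed.

End Measurability.

(** * Bad events and their total probability *)

Section Assembly.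
Context {d : measure_display} {T : measurableType d} {R : realType}
  (P : probability T R) {N : nat} (Phi Psi : 'M[R[i]]_N)
  (c : 'I_N -> T -> R[i]) (s : nat) (alpha : 'cV[R[i]]_N)
  {m : nat} (l : 'I_m -> T -> 'I_N).
Hypotheses (N0 : (0 < N)%N) (uPhi : universal_sensing_basis Phi)
  (uPsi : Psi \is unitarymx).
Hypotheses (uc : forall k, uniform_phase P (c k))
  (ic : mutually_independent P (fun k => @reim R \o c k)).
Hypotheses (s1 : (1 <= s)%N) (sp : sparse s alpha) (ul : uniform_indices P l)
  (icl : independent_signs_indices P c l).
Variables (L n r : nat) (t : R).
Hypotheses (mLn : m = (L * n + r)%N) (n0 : (0 < n)%N).
(** If real and imaginary parts of an entry are at most [t], its squared modulus is at most
    [2 t^2 = mu / N]. *)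
Let mu : R := 2 * t ^+ 2 * N%:R.
Hypotheses (mu1 : 1 <= mu) (NL : N%:R / 4 ^+ L <= 1 / 4 :> R).

Let U w := fun_of_matrix (Ac Phi Psi (c ^~ w)).
Let S := [set k | alpha k 0 != 0]%SET.
Let a k := alpha k 0.
Let sample w : m.-tuple 'I_N := [tuple l r w | r < m].

Let mc i : measurable_fun setT (@reim R \o c i) := uniform_phase_measurable (uc i).

Definition flat_phases w := [forall k, normc (c k w) ^+ 2 == 1].
Definition coherent w := [forall j, forall k, small t (U w j k)].
Let fail w u := ~~ golf_success (U w) S n L a u.
(** Golfing failure counts only when the phases are good; this is what makes the mean over samples
    small for every [w]. *)
Let H (u : m.-tuple 'I_N) : set T :=
  [set w | flat_phases w && coherent w && fail w u].

(** Stated over an arbitrary space, to be used both on [T] and on [T] with the sigma-algebra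
    generated by the phases. *)
Let measurable_flat_phases d' (T' : measurableType d') (c' : 'I_N -> T' -> R[i]) :
  (forall i, measurable_fun setT (@reim R \o c' i)) ->
  measurable [set w | [forall k, normc (c' k w) ^+ 2 == 1]].
Proof.
move=> mc'; apply: measurable_forall => k.
by apply: measurable_unit_norm; exact: cmeasurable_reim.
Qed.

Let measurable_coherent d' (T' : measurableType d') (c' : 'I_N -> T' -> R[i]) :
  (forall i, measurable_fun setT (@reim R \o c' i)) ->
  measurable [set w | [forall j, forall k, small t (Ac Phi Psi (c' ^~ w) j k)]].
Proof.
move=> mc'; apply: measurable_forall => j; apply: measurable_forall => k.
by apply: measurable_small; exact: measurable_Ac.
Qed.

(** The family [c'] is [c] on [T] with the sigma-algebra generated by the phases; measurability
    there is the claim. *)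
Let sigma_H u : g_sigma_preimage (fun k => @reim R \o c k) (H u).
Proof.
pose G : set (set T) :=
  \big[setU/set0]_(k < N) preimage_set_system setT (@reim R \o c k) measurable.
pose c' : 'I_N -> g_sigma_algebraType G -> R[i] := c.
have mc' i : measurable_fun setT (@reim R \o c' i).
  move=> _ B mB; rewrite setTI.
  exact: (g_sigma_preimage_gen (Y := fun k => @reim R \o c k) i mB).
change (measurable (H u : set (g_sigma_algebraType G))).
apply: measurable_andb.
  apply: measurable_andb; first exact: (measurable_flat_phases mc').
  exact: (measurable_coherent mc').
rewrite (_ : [set w | _] =
    ~` [set w | golf_success (fun_of_matrix (Ac Phi Psi (c' ^~ w))) S n L a u]).
  by apply: measurableC; apply: measurable_golf_success => j k; exact: measurable_Ac.
by apply/seteqP; split => w /= /negP.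
Qed.

Let sR : 1 <= s%:R :> R. Proof. by rewrite (ler_nat R 1). Qed.

Let Ss : #|S|%:R <= s%:R :> R.
Proof.
rewrite ler_nat; apply: leq_trans sp.
by apply: subset_leq_card; apply/fintype.subsetP => k; rewrite !inE.
Qed.

Let a0 k : k \notin S -> a k = 0.
Proof. by rewrite inE negbK => /eqP. Qed.

Let delta : R := (1 + N%:R) * (L%:R * (4 * N%:R * expR (- (n%:R / (2048 * mu * s%:R))))).

(** For bad phases no [H u] contains [w] and the mean is 0. For good phases [U w] is a fixed unitary
    coherent matrix, and the mean is the failure probability of golfing over the rows. *)
Let average_H w : N%:R ^- m * \sum_u \1_(H u) w <= delta.
Proof.
have delta0 : 0 <= delta.
  apply: mulr_ge0; first by rewrite addr_ge0.
  apply: mulr_ge0; first exact: ler0n.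
  by apply: mulr_ge0; [exact: mulr_ge0 | exact: expR_ge0].
have [/andP[/forallP fl /forallP coh]|ngood] :=
  boolP (flat_phases w && coherent w); last first.
  rewrite big1 ?mulr0 // => u _; rewrite indicE memNset // /H /=.
  by rewrite (negPf ngood).
have c1 k : normc (c k w) ^+ 2 = 1 by apply/eqP.
have eH u : \1_(H u) w = (fail w u)%:R :> R.
  rewrite indicE; suff -> : (w \in H u) = fail w u by [].
  apply/idP/idP; rewrite inE /H /=.
    by case/andP.
  by move=> ->; rewrite andbT; apply/andP; split; apply/forallP.
under eq_bigr do rewrite eH.
have := golf_success_fail N0 (U := U w) n0 mu1 sR Ss _ _ L r a0.
rewrite -mLn avg_tuple; apply.
- by move=> k i; exact: (Ac_orthonormal uPhi.1 uPsi k i c1).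
- move=> j k; move/forallP: (coh j) => /(_ k) /andP[h1 h2].
  rewrite sqr_normcE /mu mulfK; last by rewrite pnatr_eq0 -lt0n.
  move: h1 h2; rewrite !ler_norml => /andP[h1 h2] /andP[h3 h4]; nra.
Qed.

Definition failure_bound : R :=
  4 * N%:R ^+ 2 * expR (1 / 2 - Num.sqrt N%:R * t / 2) + delta.

Let recovery w : flat_phases w -> coherent w -> golf_success (U w) S n L a (sample w) ->
  let A := Ac_rows Phi Psi (fun k => c k w) (fun r => l r w) in
  unique_minimizer (@l1norm R N)
    [set alpha' : 'cV[R[i]]_N | A *m alpha = A *m alpha'] alpha.
Proof.
move=> fl coh gs A.
(* The difference [h] to a feasible competitor is annihilated by the sampled rows. This one claim
   yields both minimality and uniqueness. *)
have key x' : A *m alpha = A *m x' -> l1norm x' <= l1norm alpha -> x' = alpha.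
  move=> eA; rewrite /l1norm => le.
  pose h k := x' k 0 - a k.
  have hl j : j \in (sample w : seq 'I_N) -> inner (U w) h j = 0.
    move=> /tnthP[r' ->]; rewrite tnth_mktuple /inner.
    have := congr1 (fun B : 'cV_m => B r' 0) eA; rewrite [LHS]mxE [RHS]mxE => {}eA.
    under eq_bigr do rewrite mulrBr.
    rewrite sumrB; apply/eqP; rewrite subr_eq0; apply/eqP.
    have AE k : A r' k = U w (l r' w) k by rewrite /A /Ac_rows mxE.
    transitivity (\sum_k A r' k * alpha k 0); last first.
      by apply: eq_bigr => k _; rewrite AE.
    by rewrite eA; apply: eq_bigr => k _; rewrite AE.
  have hle : \sum_k normc (a k + h k) <= \sum_k normc (a k).
    under eq_bigr do rewrite /h addrC subrK -Re_norm.
    by under [leRHS]eq_bigr do rewrite -Re_norm.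
  have h0 := golf_success_recovery NL a0 gs hl hle.
  by apply/matrixP => k z; rewrite ord1; apply/eqP; rewrite -subr_eq0; apply/eqP/h0.
split; last by move=> x' [Fx' /(_ _ erefl)]; exact: key.
split=> // x' Fx'; have [//|lt] := leP (l1norm alpha) (l1norm x').
by have e := key _ Fx' (ltW lt); rewrite e ltxx in lt.
Qed.

(** Three bad events are discarded: non-unit phases, of probability 0; an incoherent matrix, by a
    union bound over [N^2] entries and four directions; a golfing failure, by [sampling_bound]. *)
Lemma recovery_probability :
  with_probability_at_least P (1 - failure_bound) (fun w =>
    let A := Ac_rows Phi Psi (fun k => c k w) (fun r => l r w) in
    let y := A *m alpha in
    unique_minimizer (@l1norm R N)
      [set alpha' : 'cV[R[i]]_N | y = A *m alpha'] alpha).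
Proof.
have [mH PH] := sampling_bound ul mc icl sigma_H average_H.
set E3 := [set w | _] in mH PH.
have mE1 : measurable [set w | flat_phases w] := measurable_flat_phases mc.
have mE2 : measurable [set w | coherent w] := measurable_coherent mc.
pose E1 := ~` [set w | flat_phases w]; pose E2 := ~` [set w | coherent w].
have m1 : measurable E1 by exact: measurableC.
have m2 : measurable E2 by exact: measurableC.
have P1 : (P E1 <= 0)%E.
  have mk k : measurable [set w | normc (c k w) ^+ 2 = 1].
    rewrite (_ : [set w | _] = [set w | normc (c k w) ^+ 2 == 1]).
      by apply: measurable_unit_norm; exact: cmeasurable_reim.
    by apply/seteqP; split => w /eqP.
  apply: le_trans (probability_union_bound P m1 (r := enum 'I_N)
    (F := fun k => ~` [set w | normc (c k w) ^+ 2 = 1]) _ _) _.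
  - by move=> k; exact: measurableC.
  - move=> w /= /negP; rewrite negb_forall => /existsP[k /eqP hk].
    by exists k; rewrite ?mem_enum.
  - rewrite big1 // => k _; apply: etrans (probability_setC P (mk k)) _.
    by rewrite uniform_phase_unit // subee.
have P2 : (P E2 <= (4 * N%:R ^+ 2 * expR (1 / 2 - Num.sqrt N%:R * t / 2))%:E)%E.
  pose F (x : 'I_N * 'I_N * (bool * bool)) : set T :=
    [set w | t < direction x.2 (U w x.1.1 x.1.2)].
  have mF x : measurable (F x).
    by apply: measurable_direction; exact: measurable_Ac.
  apply: le_trans (probability_union_bound P m2 (r := index_enum _) mF _) _.
    move=> w /= /negP; rewrite negb_forall => /existsP[j]; rewrite negb_forall.
    by move=> /existsP[k /not_small[p h]]; exists (j, k, p); rewrite ?mem_index_enum.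
  apply: le_trans (lee_sum _ (fun x _ =>
    Ac_direction_tail N0 uc ic uPhi uPsi x.2 x.1.1 x.1.2 t)) _.
  rewrite sumEFin lee_fin sumr_const !card_prod !card_ord card_bool -[leLHS]mulr_natl.
  by rewrite ler_wpM2r ?expR_ge0 // -natrX -natrM ler_nat mulnC.
have mU3 : measurable (E1 `|` E2 `|` E3).
  by apply: measurableU => //; exact: measurableU.
exists (~` (E1 `|` E2 `|` E3)); split; first exact: measurableC.
- rewrite (probability_setC P mU3) EFinB leeB //.
  apply: le_trans (measureU2 _ _ _) _ => //; first exact: measurableU.
  rewrite /failure_bound EFinD; apply: leeD => //.
  apply: le_trans (measureU2 _ m1 m2) _.
  by rewrite -[leRHS]add0e; exact: leeD.
- move=> w /= nE; have fl : flat_phases w.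
    by apply: contrapT => h; apply: nE; left; left.
  have co : coherent w by apply: contrapT => h; apply: nE; left; right.
  apply: recovery => //; apply: contrapT => /negP gs; apply: nE; right.
  by rewrite /E3 /H /= fl co.
Qed.

End Assembly.

(** * Choice of the constants *)

Lemma ln2_ge_half (R : realType) : 1 / 2 <= ln 2 :> R.
Proof.
rewrite -ler_expR lnK ?posrE //.
(* At its endpoint the quadratic bound reads [expR (1 / 2) <= 2]. *)
by apply: le_trans (expR_le_quadratic (lexx _)) _; lra.
Qed.

Lemma expR_powR (R : realType) (N : nat) (x : R) : (0 < N)%N ->
  N%:R `^ x = expR (x * ln N%:R).
Proof. by move=> N0; rewrite /powR gt_eqF // ltr0n. Qed.

(** Absorbs the polynomial prefactors of the union bounds: [k = 2] for coherence, [k = 3] for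
    golfing. *)
Lemma mulXn_powR (R : realType) (N k : nat) (x : R) : (0 < N)%N ->
  N%:R ^+ k * expR (- ((x + k%:R) * ln N%:R)) = N%:R `^ (- x).
Proof.
move=> N0; rewrite expR_powR //.
have -> : N%:R ^+ k = expR (k%:R * ln N%:R) :> R.
  by rewrite expRM_natl lnK // posrE ltr0n.
by rewrite -expRD; congr expR; ring.
Qed.

Lemma batch_count (R : realType) (N : nat) : (2 <= N)%N ->
  let L := (trunc_log 2 N).+1 in
  [/\ (L <= N)%N, N%:R / 4 ^+ L <= 1 / 4 :> R & L%:R <= 4 * ln N%:R :> R].
Proof.
move=> N2 L; have N0 : (0 < N)%N by exact: ltnW.
have /andP[lo hi] := trunc_log_bounds (isT : (1 < 2)%N) N0.
split.
- exact: leq_trans (ltn_expl _ (isT : (1 < 2)%N)) lo.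
(* From [N + 1 <= 2 ^ L] and [4 N <= (N + 1)^2]. *)
- have h : (4 * N <= 4 ^ L)%N.
    have := (nat_AGM2 N 1).1; rewrite muln1 addn1 => /leq_trans; apply.
    by rewrite -[4%N]/(2 ^ 2)%N -expnM mulnC expnM leq_exp2r.
  rewrite ler_pdivrMr ?exprn_gt0 // mulrAC mul1r ler_pdivlMr // mulrC.
  by rewrite -natrX -natrM ler_nat.
have l2 := ln2_ge_half R.
have lnN : ln 2 <= ln N%:R :> R.
  by rewrite ler_ln ?posrE ?ltr0n // (ler_nat R 2).
have : (trunc_log 2 N)%:R * ln 2 <= ln N%:R :> R.
  rewrite mulr_natl -lnXn // ler_ln ?posrE ?exprn_gt0 ?ltr0n // -natrX ler_nat.
  exact: lo.
rewrite /L -[(trunc_log 2 N).+1%:R]natr1.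
move: (trunc_log 2 N)%:R (ler0n R (trunc_log 2 N)) => k k0 kl.
have := ler_wpM2l k0 l2; lra.
Qed.

Theorem corollary1 (R : realType) :
  exists K : R, 0 < K /\
  forall rho : R, 0 < rho ->
  exists Crho : R, 0 < Crho /\
  forall (N : nat) (Phi Psi : 'M[R[i]]_N)
    (d : measure_display) (T : measurableType d) (P : probability T R)
    (c : 'I_N -> T -> R[i])
    (s : nat) (alpha : 'cV[R[i]]_N)
    (m : nat) (l : 'I_m -> T -> 'I_N),
  (2 <= N)%N ->
  rho < ln N%:R ^+ 3 ->
  universal_sensing_basis Phi ->
  Psi \is unitarymx ->
  rademacher P c \/ steinhaus P c ->
  (1 <= s)%N ->
  sparse s alpha ->
  uniform_indices P l ->
  independent_signs_indices P c l ->
  Crho * s%:R * ln N%:R ^+ 5 <= m%:R ->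
  with_probability_at_least P (1 - K * N%:R `^ (- rho))
    (fun w =>
       let A := Ac_rows Phi Psi (fun k => c k w) (fun r => l r w) in
       let y := A *m alpha in
       unique_minimizer (@l1norm R N)
         [set alpha' : 'cV[R[i]]_N | y = A *m alpha'] alpha).
Proof.
(* The first summand comes from coherence, the second from golfing. *)
exists (4 * expR (1 / 2) + 8); split.
  by rewrite addr_gt0 // mulr_gt0 // expR_gt0.
move=> rho rho0.
have r2 : 0 < rho + 2 by lra.
have r3 : 0 < rho + 3 by lra.
(* With [mu = 8 (rho + 2)^2 x^2] and [x = ln N], a batch of [n >= B s x^3] rows gives
   [n / (2048 mu s) >= (rho + 3) x]. *)
have [B [BE B0]] : exists B : R, B = 2048 * (8 * (rho + 2) ^+ 2) * (rho + 3) /\ 0 < B.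
  eexists; split; first reflexivity.
  apply: mulr_gt0; last exact: r3.
  apply: mulr_gt0; first by rewrite ltr0n.
  by apply: mulr_gt0; [rewrite ltr0n|exact: exprn_gt0].
(* 8 B accounts for L <= 4 ln N, for ln N >= 1/2 and for rounding in n = m %/ L,
   64 for n + 1 in place of n. *)
exists (8 * B + 64); split; first lra.
move=> N Phi Psi d T P c s alpha m l N2 _ uPhi uPsi uc s1 sp ul icl hm.
have N0 : (0 < N)%N by exact: ltnW.
have NR : 0 < N%:R :> R by rewrite ltr0n.
have [LN NL Lln] := batch_count R N2.
move: (trunc_log 2 N).+1 (ltn0Sn (trunc_log 2 N)) LN NL Lln => L L0 LN NL Lln.
have lnN : 1 / 2 <= ln N%:R :> R.
  by apply: le_trans (ln2_ge_half R) _; rewrite ler_ln ?posrE ?ltr0n // (ler_nat R 2).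
pose x : R := ln N%:R; rewrite -/x in lnN Lln hm.
(* [tau] is chosen so that [sqrt N * t / 2 = (rho + 2) x], which beats the [N^2] entries by a factor
   [N^-rho]. *)
pose n := (m %/ L)%N; pose tau : R := 2 * (rho + 2) * x.
pose t : R := tau / Num.sqrt N%:R.
have sN : 0 < Num.sqrt N%:R :> R by rewrite sqrtr_gt0.
have tau0 : 0 <= tau by rewrite /tau; nra.
have muE : 2 * t ^+ 2 * N%:R = 8 * (rho + 2) ^+ 2 * x ^+ 2.
  rewrite /t expr_div_n sqr_sqrtr ?ltW // -mulrA mulfVK ?gt_eqF // /tau; ring.
have mu1 : 1 <= 2 * t ^+ 2 * N%:R.
  rewrite muE.
  have h : 1 <= (rho + 2) * x by nra.
  have -> : 8 * (rho + 2) ^+ 2 * x ^+ 2 = 8 * ((rho + 2) * x) ^+ 2 by ring.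
  nra.
have sR : 1 <= s%:R :> R by rewrite (ler_nat R 1).
have nB : B * s%:R * x ^+ 3 <= n%:R.
  have x0 : 0 < x by lra.
  have mn : m%:R <= (n%:R + 1) * (4 * x).
    apply: (@le_trans _ _ ((n.+1 * L)%:R)).
      by rewrite ler_nat ltnW // /n -ltn_divLR.
    by rewrite natrM -natr1 ler_wpM2l // addr_ge0.
  have h1 : (2 * B + 16) * s%:R * x ^+ 4 <= n%:R + 1.
    rewrite -(ler_pM2r (mulr_gt0 (ltr0n R 4) x0)); apply: le_trans mn.
    by apply: le_trans hm; rewrite le_eqVlt; apply/orP; left; apply/eqP; ring.
  (* Hence the surplus [8 s x^3] in [h2] pays for the 1 in [n + 1]. *)
  have y1 : 1 / 8 <= s%:R * x ^+ 3.
    have : 1 / 8 <= x ^+ 3.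
      have : (1 / 2) ^+ 3 <= x ^+ 3 by rewrite lerXn2r ?nnegrE ?divr_ge0 // ltW.
      by rewrite (_ : (1 / 2) ^+ 3 = 1 / 8 :> R) //; field.
    nra.
  have h2 : (B + 8) * (s%:R * x ^+ 3) <= (2 * B + 16) * s%:R * x ^+ 4.
    have -> : (2 * B + 16) * s%:R * x ^+ 4 = (B + 8) * (s%:R * x ^+ 3) * (2 * x) by ring.
    rewrite ler_peMr //; last by lra.
    by rewrite mulr_ge0 ?addr_ge0 ?(ltW B0) //; lra.
  rewrite -mulrA; lra.
have n0 : (0 < n)%N.
  rewrite -(ltr0n R); apply: lt_le_trans nB.
  by rewrite !mulr_gt0 ?exprn_gt0 ?(lt_le_trans _ sR) ?(lt_le_trans _ lnN).
have mLn : m = (L * n + m %% L)%N by rewrite mulnC -divn_eq.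
have [uc' ic] : (forall k, uniform_phase P (c k)) /\
    mutually_independent P (fun k => @reim R \o c k).
  by case: uc => -[h1 h2]; split=> // k; [left|right].
have [E [mE PE QE]] := recovery_probability N0 uPhi uPsi uc' ic s1 sp ul icl mLn n0 mu1 NL.
exists E; split => //; apply: le_trans PE; rewrite lee_fin lerB // mulrDl.
rewrite /failure_bound; apply: lerD.
  have -> : Num.sqrt N%:R * t / 2 = (rho + 2%:R) * x.
    by rewrite /t /tau mulrCA mulfV ?gt_eqF // mulr1; field.
  rewrite expRD -(mulXn_powR 2 rho N0) -/x le_eqVlt; apply/orP; left; apply/eqP; ring.
have s0 : 0 < s%:R :> R by rewrite (lt_le_trans ltr01).
have mu0 := lt_le_trans ltr01 mu1.
have e : expR (- (n%:R / (2048 * (2 * t ^+ 2 * N%:R) * s%:R))) <= expR (- ((rho + 3%:R) * x)).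
  rewrite ler_expR lerN2 ler_pdivlMr; last first.
    by apply: mulr_gt0; [apply: mulr_gt0; [rewrite ltr0n|exact: mu0]|exact: s0].
  by apply: le_trans nB; rewrite muE BE le_eqVlt; apply/orP; left; apply/eqP; ring.
rewrite -(mulXn_powR 3 rho N0) -/x.
have LR : L%:R <= N%:R :> R by rewrite ler_nat.
have N1 : 1 <= N%:R :> R by rewrite (ler_nat R 1).
(* The prefactor is at most [8 N^3] because [1 + N <= 2 N] and [L <= N]. *)
have -> : 8 * (N%:R ^+ 3 * expR (- ((rho + 3%:R) * x))) =
  2 * N%:R * (N%:R * (4 * N%:R * expR (- ((rho + 3%:R) * x)))) by ring.
apply: ler_pM; [by rewrite addr_ge0| |by lra|].
  apply: mulr_ge0; first exact: ler0n.
  by apply: mulr_ge0; [exact: mulr_ge0|exact: expR_ge0].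
apply: ler_pM; [exact: ler0n| |exact: LR|].
  by apply: mulr_ge0; [exact: mulr_ge0|exact: expR_ge0].
by apply: ler_wpM2l; [exact: mulr_ge0|exact: e].
Qed.
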